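(* Let $q:[0,\pi]\to\mathbb{R}$ be a potential admitting an absolutely convergent Fourier cosine expansion $$q(x)=\frac{q_0}{2}+\sum_{k=1}^\infty q_k\cos(kx),\qquad q_k=\frac{2}{\pi}\int_0^\pi q(x)\cos(kx)\,dx\quad (k=0,1,2,\dots),$$ and let $\mu_0<\mu_1\le\mu_2\le\cdots$ be the eigenvalues of the Neumann problem $-u''+qu=\mu u$ on $(0,\pi)$, $u'(0)=u'(\pi)=0$. Then for all $n\ge0$, $$\sum_{k=0}^{n}\left(\mu_k-k^2-\frac{q_0}{2}\right)\le\frac12\sum_{k=1}^{n}q_{2k}.$$ Equality for some $n\ge0$ implies that $q$ is constant. As $n\to\infty$, the right-hand side of this inequality converges to $$-\frac{1}{2\pi}\int_0^\pi q(x)\,dx+\frac{q(0)+q(\pi)}{4}.$$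
   Context: The eigenvalue problem is understood in the usual weak sense (form domain $H^1(0,\pi)$). Eigenvalues are listed in increasing order, repeated according to multiplicity, with numbering starting at $0$. Note that $q_0/2=\frac1\pi\int_0^\pi q(x)\,dx$. An empty sum is $0$. *)

(* Defs.v *)
From HB Require Import structures.
From mathcomp Require Import all_boot all_order all_algebra.
From mathcomp Require Import all_classical all_reals all_analysis.

Set Implicit Arguments.
Unset Strict Implicit.
Unset Printing Implicit Defensive.

Import Order.TTheory GRing.Theory Num.Theory.
Import numFieldNormedType.Exports.

Local Open Scope classical_set_scope.
Local Open Scope ring_scope.

Definition itv0pi {R : realType} : set R := `]0, pi[%classic.

Definition cos_coef (R : realType) (q : R -> R) (k : nat) : R :=
  2 / pi * \int[@lebesgue_measure R]_(x in itv0pi) (q x * cos (k%:R * x)).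

(* At x = 0 the cosines equal 1, so absolute convergence of the expansion on
   [0, pi] amounts to summability of the coefficients. Only the values of q on
   [0, pi] matter. *)
Definition abs_cvg_cos_expansion (R : realType) (q : R -> R) : Prop :=
  cvgn (series (fun k => `|cos_coef q k|)) /\
  (forall x : R, 0 <= x <= pi ->
    (fun n => cos_coef q 0 / 2
              + \sum_(1 <= k < n.+1) cos_coef q k * cos (k%:R * x))
      @ \oo --> q x).

Definition L2 (R : realType) (u : R -> R) : Prop :=
  (u \_ itv0pi) \in Lfun (@lebesgue_measure R) 2%:E.

(* C^1 functions with compact support in (0, pi), extended by 0 to the line. *)
Definition test_function (R : realType) (phi : R -> R) : Prop :=
  [/\ forall x : R, derivable phi x 1,
      continuous (derive1 phi) &
      exists a b : R, [/\ 0 < a, b < pi &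
        forall x : R, ~ (a <= x <= b) -> phi x = 0]].

(* u is in H^1(0, pi) with weak derivative du. *)
Definition H1 (R : realType) (u du : R -> R) : Prop :=
  [/\ L2 u, L2 du &
      forall phi : R -> R, test_function phi ->
        \int[@lebesgue_measure R]_(x in itv0pi) (u x * derive1 phi x) =
        - \int[@lebesgue_measure R]_(x in itv0pi) (du x * phi x)].

(* Weak solutions of -u'' + q u = lam u with Neumann conditions: since the test
   functions v range over all of H^1(0, pi), the conditions u'(0) = u'(pi) = 0
   are the natural boundary conditions of the form. The zero function is
   included, so these are the elements of the eigenspace of lam. *)
Definition weak_neumann (R : realType) (q : R -> R) (lam : R) (u : R -> R) :
    Prop :=
  exists du : R -> R, H1 u du /\
    forall v dv : R -> R, H1 v dv ->
      \int[@lebesgue_measure R]_(x in itv0pi) (du x * dv x)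
      + \int[@lebesgue_measure R]_(x in itv0pi) (q x * u x * v x)
      = lam * \int[@lebesgue_measure R]_(x in itv0pi) (u x * v x).

(* Linear independence modulo equality almost everywhere on (0, pi). *)
Definition lin_indep (R : realType) (d : nat) (u : 'I_d -> R -> R) : Prop :=
  forall c : 'I_d -> R,
    {ae @lebesgue_measure R, forall x : R,
        itv0pi x -> \sum_(i < d) c i * u i x = 0} ->
    forall i, c i = 0.

(* mu_0 <= mu_1 <= ... lists all eigenvalues with multiplicity: for every real
   lam, the dimension of the eigenspace of lam (0 if lam is not an eigenvalue)
   is the number of indices k such that mu k = lam. Two elements of
   {0, 1, ..., oo} are equal as soon as they bound the same natural numbers d
   from above. *)
Definition neumann_eigenvalues (R : realType) (q : R -> R) (mu : nat -> R) :
    Prop :=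
  (forall k, mu k <= mu k.+1) /\
  (forall (lam : R) (d : nat),
    (exists u : 'I_d -> R -> R,
       (forall i, weak_neumann q lam (u i)) /\ lin_indep u) <->
    (exists k : 'I_d -> nat, injective k /\ forall i, mu (k i) = lam)).

(* Main.v *)
Require Import Defs.
From HB Require Import structures.
From mathcomp Require Import all_boot all_order all_algebra.
From mathcomp Require Import all_classical all_reals all_analysis.
From mathcomp Require Import ring lra zify.
Import Order.TTheory GRing.Theory Num.Theory.
Import numFieldNormedType.Exports.
Local Open Scope classical_set_scope.
Local Open Scope ring_scope.

(** In the orthonormal basis made of 1 / sqrt pi and sqrt (2 / pi) cos(kx), k >= 1,
    the form of the Neumann problem, u |-> int u'^2 + int q u^2, has the infinite
    matrix [galerkin]

      A_jk = k^2 [j = k] + s_j s_k (a_|j-k| + a_(j+k)) / 2,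

    where a_k is the k-th cosine coefficient of q, s_0 = sqrt (1/2) and s_k = 1 for
    k >= 1. Its diagonal entries are A_00 = a_0 / 2 and
    A_kk = k^2 + a_0 / 2 + a_2k / 2. The inequality therefore says that
    mu_0 + ... + mu_n is at most A_00 + ... + A_nn, the trace of the form on the span
    of the first n + 1 cosines. This is an instance of Ky Fan's principle: the sum of
    the n + 1 lowest eigenvalues is a lower bound for the trace of the form on every
    orthonormal family of n + 1 vectors.

    The principle is proved for symmetric matrices, where successive minimisation
    over unit spheres gives the lowest eigenvectors ([exists_lowest_eigenvectors],
    [ky_fan]), and carried over to the differential operator by letting the size N of
    the truncation of A grow. As the a_k are absolutely summable, the cosine
    coefficients c of a normalised eigenvector of the truncated matrix satisfy a
    bound on the sum of k^2 |c_k| that does not depend on N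
    ([eigenvector_l1_bounds]). Along an ultrafilter on N the cosine polynomials
    with these coefficients and their derivatives converge uniformly
    ([ultra_unif_lim]), while the cosine polynomials solve -u'' + q u = l u up to a
    residual that tends uniformly to 0 ([residual_bound]). The limits are weak Neumann
    eigenfunctions ([weak_limit]); they are orthogonal, and the limits lam_k of the
    matrix eigenvalues inherit Ky Fan's inequality for all orthonormal families of
    cosine polynomials ([exists_eigenfunctions]). Counting multiplicities gives
    mu_k <= lam_k ([nondecr_le_of_multiplicities]), hence Ky Fan's inequality for the
    mu_k ([sum_mu_le_energy]).

    If equality holds for n, then the first n + 1 basis vectors minimise the trace.
    Rotating the i-th one slightly towards the m-th one, for i <= n < m, shows that
    A_im = 0, that is a_(m-i) + a_(m+i) = 0 ([galerkin_offdiag_eq0]). With i = 0 this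
    gives a_m = 0 for m > n; with i = n and m = n + j it then gives a_j = 0 for every
    j >= 1, so q is constant.

    For the limit of the right-hand side, add the expansions of q at 0 and at pi: the
    coefficients of odd index cancel ([sum_even_coefs]). *)

(** * Lowest eigenvectors of a symmetric matrix *)

Lemma cvg_sum_seq {R : realType} {T : Type} {F : set_system T} {FF : Filter F}
    (I : Type) (r : seq I) (P : pred I) (f : I -> T -> R) (l : I -> R) :
    (forall i, P i -> f i x @[x --> F] --> l i) ->
  \sum_(i <- r | P i) f i x @[x --> F] --> \sum_(i <- r | P i) l i.
Proof. by move=> fl; apply: cvg_big => //; exact: add_continuous. Qed.

Lemma continuous_sum_seq {R : realType} {T : topologicalType}
    (I : Type) (r : seq I) (f : I -> T -> R) :
    (forall i, continuous (f i)) ->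
  continuous (fun x => \sum_(i <- r) f i x).
Proof. by move=> fl x; apply: cvg_sum_seq => i _; exact: fl. Qed.

Lemma mulmx_trE (R : realType) N (u v : 'rV[R]_N) :
  (u *m v^T) 0 0 = \sum_(k < N) u 0 k * v 0 k.
Proof. by rewrite mxE; apply: eq_bigr => k _; rewrite mxE. Qed.

Lemma sqnorm_ge0 (R : realType) N (u : 'rV[R]_N) : 0 <= (u *m u^T) 0 0.
Proof. by rewrite mulmx_trE; apply: sumr_ge0 => k _; rewrite -expr2 sqr_ge0. Qed.

Lemma sqnorm_eq0 (R : realType) N (u : 'rV[R]_N) : (u *m u^T) 0 0 = 0 -> u = 0.
Proof.
rewrite mulmx_trE => /psumr_eq0P H; apply/rowP => k; rewrite mxE.
have /eqP := H (fun i _ =>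
  eq_ind_r (fun z => 0 <= z) (sqr_ge0 _) (esym (expr2 (u 0 i)))) k isT.
by rewrite mulf_eq0 orbb => /eqP.
Qed.

Lemma quadratic_form_continuous (R : realType) N (A : 'M[R]_N) :
  continuous (fun u : 'rV[R]_N => (u *m A *m u^T) 0 0 : R).
Proof.
have -> : (fun u : 'rV[R]_N => (u *m A *m u^T) 0 0 : R) =
    (fun u => \sum_(k < N) (\sum_(l < N) u 0 l * A l k) * u 0 k).
  apply/funext => v; rewrite mulmx_trE; apply: eq_bigr => k _.
  by rewrite mxE.
apply: (@continuous_sum_seq R 'rV[R]_N) => k x.
apply: (@cvgM R _ (nbhs x)); last exact: coord_continuous.
apply: (@continuous_sum_seq R 'rV[R]_N) => l z.
by apply: (@cvgMr_tmp R _ (nbhs z)); exact: coord_continuous.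
Qed.

Lemma bilinear_form_sym {R : realType} N (A : 'M[R]_N) (u v : 'rV[R]_N) :
  A^T = A -> (u *m A *m v^T) 0 0 = (v *m A *m u^T) 0 0.
Proof.
move=> As; rewrite -[LHS](mxE (trmx_key) (fun i j => (u *m A *m v^T) j i)).
by rewrite -/(trmx (u *m A *m v^T)) !trmx_mul trmxK As mulmxA.
Qed.

(** First-order optimality: for small t the sign of the expression is that of t b.
    *)
Lemma linear_term_eq0 {R : realType} (b c : R) :
  (forall t : R, 0 <= t * b *+ 2 + t ^+ 2 * c) -> b = 0.
Proof.
move=> H; have [c0|c0] := leP c 0.
  have h1 := H 1; have h2 := H (-1); nra.
have h := H (- b / c).
have : - b / c * b *+ 2 + (- b / c) ^+ 2 * c = - (b ^+ 2 / c).
  by field; rewrite gt_eqF.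
move=> e; rewrite e oppr_ge0 in h.
have : b ^+ 2 <= 0 by rewrite -(@pmulr_lle0 _ c^-1) ?invr_gt0.
by move=> h2; apply/eqP; rewrite -sqrf_eq0 eq_le h2 sqr_ge0.
Qed.

Lemma exists_unit_orthogonal (R : realType) N n (X : 'M[R]_(n, N)) : (n < N)%N ->
  exists2 y : 'rV[R]_N, y *m X^T = 0 & (y *m y^T) 0 0 = 1.
Proof.
move=> nN.
have /rowV0Pn[v /sub_kermxP vX v0] : kermx X^T != 0.
  rewrite -mxrank_eq0 mxrank_ker -lt0n subn_gt0.
  by rewrite (leq_ltn_trans _ nN)// rank_leq_col.
have vv0 : 0 < (v *m v^T) 0 0.
  by rewrite lt_neqAle sqnorm_ge0 andbT eq_sym; apply: contra v0 => /eqP/sqnorm_eq0->.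
exists ((Num.sqrt ((v *m v^T) 0 0))^-1 *: v).
  by rewrite -scalemxAl vX scaler0.
rewrite linearZ /= -scalemxAl -scalemxAr scalerA mxE -expr2 exprVn sqr_sqrtr ?ltW//.
by rewrite mulVf// gt_eqF.
Qed.

(** One step of successive minimisation. The vector y minimises the Rayleigh
    quotient on the unit sphere of the orthogonal complement of the rows of X.
    Optimality says that y A - l y is orthogonal to that complement; as the rows of
    X are eigenvectors, y A - l y also lies in the complement, so it vanishes. *)
Lemma exists_next_eigenvector (R : realType) N n (A : 'M[R]_N)
    (X : 'M[R]_(n, N)) (d : 'rV[R]_n) :
    A^T = A -> (n < N)%N -> X *m A = diag_mx d *m X ->
  exists (y : 'rV[R]_N) (l : R), [/\ (y *m y^T) 0 0 = 1, y *m X^T = 0,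
    y *m A = l *: y &
    forall w : 'rV[R]_N, w *m X^T = 0 ->
      l * (w *m w^T) 0 0 <= (w *m A *m w^T) 0 0].
Proof.
move=> As nN XA.
pose K := [set y : 'rV[R]_N | y *m X^T = 0 /\ (y *m y^T) 0 0 = 1].
have K0 : K !=set0.
  by have [y yX yy] := exists_unit_orthogonal _ _ _ X nN; exists y.
have Kb : bounded_set K.
  exists 1; split; first exact: num_real.
  move=> M M1 y [_ yy].
  rewrite /= (le_trans _ (ltW M1))// [leLHS]mx_normrE; apply/bigmax_leP; split=> //.
  move=> [i k] _ /=; rewrite ord1 {i}.
  rewrite -(@ler_pXn2r _ 2)// ?nnegrE// expr1n real_normK ?num_real// -yy mulmx_trE.
  rewrite (bigD1 k)//= expr2 lerDl sumr_ge0// => j _.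
  by rewrite -expr2 sqr_ge0.
have Kc : closed K.
  have -> : K = \bigcap_(i in [set: 'I_n]) [set y : 'rV[R]_N | (y *m X^T) 0 i = 0]
     `&` [set y : 'rV[R]_N | (y *m 1%:M *m y^T) 0 0 = 1].
    apply/seteqP; split=> y /=.
      by move=> [y0 y1]; split; [move=> i _ /=; rewrite y0 mxE|rewrite mulmx1].
    by move=> [y0 y1]; split;
      [apply/rowP => i; rewrite y0// mxE|rewrite mulmx1 in y1].
  apply: closedI.
    apply: closed_bigI => i _.
    apply: ((continuous_closedP (fun y : 'rV[R]_N => (y *m X^T) 0 i)).1 _
      [set x | x = 0]); last exact: closed_eq.
    have -> : (fun y : 'rV[R]_N => (y *m X^T) 0 i) =
       (fun y => \sum_(k < N) y 0 k * X^T k i).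
      by apply/funext => v; rewrite mxE.
    by apply: (@continuous_sum_seq R 'rV[R]_N) => l z;
      apply: (@cvgMr_tmp R _ (nbhs z)); exact: coord_continuous.
  apply: ((continuous_closedP (fun y : 'rV[R]_N => (y *m 1%:M *m y^T) 0 0)).1 _
    [set x | x = 1]); last exact: closed_eq.
  exact: quadratic_form_continuous.
have Kcpt : compact K by exact: bounded_closed_compact.
have [y yK ymin] := @EVT_min_rV R N (fun u => (u *m A *m u^T) 0 0) K K0 Kcpt
  (continuous_subspaceT (@quadratic_form_continuous _ _ A)).
move: yK; rewrite inE => -[yX yy].
exists y, ((y *m A *m y^T) 0 0); set l := (y *m A *m y^T) 0 0.
have wmin (w : 'rV[R]_N) : w *m X^T = 0 ->
      l * (w *m w^T) 0 0 <= (w *m A *m w^T) 0 0.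
  move=> wX; have [ww0|ww0] := eqVneq ((w *m w^T) 0 0) 0.
    by rewrite ww0 mulr0 (sqnorm_eq0 _ _ _ ww0) !mul0mx mxE.
  have ww : 0 < (w *m w^T) 0 0 by rewrite lt_neqAle eq_sym ww0 sqnorm_ge0.
  pose s := (Num.sqrt ((w *m w^T) 0 0))^-1.
  have s2 : s ^+ 2 = ((w *m w^T) 0 0)^-1 by rewrite exprVn sqr_sqrtr ?ltW.
  have : l <= ((s *: w) *m A *m (s *: w)^T) 0 0.
    apply: ymin; rewrite inE; split; first by rewrite -scalemxAl wX scaler0.
    rewrite linearZ /= -scalemxAl -scalemxAr scalerA mxE -expr2 s2.
    by rewrite mulVf.
  rewrite linearZ /= -!scalemxAl -scalemxAr scalerA mxE -expr2 s2.
  by rewrite mulrC ler_pdivlMr.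
split=> //.
have ortho (w : 'rV[R]_N) : w *m X^T = 0 -> (y *m A *m w^T) 0 0 = l * (y *m w^T) 0 0.
  move=> wX; apply/eqP; rewrite -subr_eq0; apply/eqP.
  apply: (@linear_term_eq0 _ _ ((w *m A *m w^T) 0 0 - l * (w *m w^T) 0 0)) => t.
  have := wmin (y + t *: w).
  rewrite mulmxDl -scalemxAl wX scaler0 yX addr0 => /(_ erefl).
  have wAy : (w *m A *m y^T) 0 0 = (y *m A *m w^T) 0 0 by rewrite bilinear_form_sym.
  have wy : (w *m y^T) 0 0 = (y *m w^T) 0 0.
    by rewrite !mulmx_trE; apply: eq_bigr => k _; rewrite mulrC.
  have expand (B : 'M[R]_N) : ((y + t *: w) *m B *m (y + t *: w)^T) 0 0 =
      (y *m B *m y^T) 0 0 + t * (y *m B *m w^T) 0 0 + t * (w *m B *m y^T) 0 0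
      + t ^+ 2 * (w *m B *m w^T) 0 0.
    rewrite [(_ + _)^T]linearD /= [(_ *: _)^T]linearZ /= !mulmxDl !mulmxDr.
    rewrite -!scalemxAl -!scalemxAr !mxE; ring.
  have := expand 1%:M; rewrite !mulmx1 => ->; rewrite expand wAy wy yy -/l -subr_ge0.
  by move=> h; apply: le_trans h _; rewrite le_eqVlt; apply/orP; left; apply/eqP;
    ring.
(* A vector of the complement that the first variation shows orthogonal to itself.
   *)
pose g := y *m A - l *: y.
have gX : g *m X^T = 0.
  rewrite mulmxBl -scalemxAl yX scaler0 subr0 -mulmxA.
  have -> : A *m X^T = X^T *m diag_mx d.
    by apply: trmx_inj; rewrite !trmx_mul !trmxK As XA tr_diag_mx.
  by rewrite mulmxA yX mul0mx.
apply/eqP; rewrite -subr_eq0; apply/eqP; apply: sqnorm_eq0; rewrite -/g {1}/g.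
rewrite mulmxBl -scalemxAl.
have := ortho g gX.
by rewrite !mxE => ->; rewrite subrr.
Qed.

(** The last condition records that the eigenvalues found are the lowest ones: the
    form is at least d_i on everything orthogonal to all the rows of X. *)
Lemma exists_lowest_eigenvectors (R : realType) N n (A : 'M[R]_N) :
    A^T = A -> (n <= N)%N ->
  exists (X : 'M[R]_(n, N)) (d : 'rV[R]_n),
    [/\ X *m X^T = 1%:M, X *m A = diag_mx d *m X,
      forall i j : 'I_n, (i <= j)%N -> d 0 i <= d 0 j &
      forall (i : 'I_n) (w : 'rV[R]_N), w *m X^T = 0 ->
        d 0 i * (w *m w^T) 0 0 <= (w *m A *m w^T) 0 0].
Proof.
move=> As; elim: n => [|n IH] nN.
  exists 0, 0; split=> [||[]|[]]//; first by apply/matrixP => -[].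
  by apply/matrixP => -[].
have {IH}[X [d [XX XA ds dmin]]] := IH (ltnW nN).
have [y [l [yy yX yA lmin]]] := exists_next_eigenvector _ _ _ _ _ _ As nN XA.
rewrite -addn1; exists (col_mx X y), (row_mx d l%:M).
have Xy : X *m y^T = 0 by apply: trmx_inj; rewrite trmx_mul trmxK yX trmx0.
have yy1 : y *m y^T = 1%:M by apply/matrixP => i j; rewrite !ord1 yy mxE.
split.
- by rewrite tr_col_mx mul_col_row XX Xy yX yy1 -scalar_mx_block.
- rewrite mul_col_mx XA yA; apply/matrixP => i j.
  rewrite !mul_diag_mx !mxE; case: splitP => k ik; rewrite !mxE //.
  by rewrite !ord1 eqxx mulr1n.
- move=> i j; rewrite !mxE; case: (splitP i) => i' ->; case: (splitP j) => j' ->.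
  + exact: ds.
  + rewrite !ord1 !mxE eqxx mulr1n => _.
    have := dmin i' _ yX; rewrite yy mulr1 => /le_trans; apply.
    by rewrite yA -scalemxAl mxE yy mulr1.
  + by rewrite ord1 addn0 leqNgt ltn_ord.
  + by rewrite !ord1.
- move=> i w; rewrite tr_col_mx mul_mx_row => /eqP.
  rewrite -row_mx0 => /eqP/eq_row_mx[wX _].
  rewrite mxE; case: splitP => k ik; first exact: dmin.
  by rewrite ord1 mxE eqxx mulr1n; exact: lmin.
Qed.

(** Decompose the rows of Y along the rows of X, with coefficients C, and a
    remainder P. The trace splits as the sum of d_j t_j and the trace of the form on
    P, where t_j is the squared norm of the j-th column of C. The second term is at
    least the largest d times the sum of the 1 - t_j, and t_j <= 1 by Bessel's
    inequality. *)
Lemma ky_fan (R : realType) N n (A : 'M[R]_N) (X Y : 'M[R]_(n, N))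
    (d : 'rV[R]_n) :
    A^T = A -> X *m X^T = 1%:M -> X *m A = diag_mx d *m X ->
    (forall i j : 'I_n, (i <= j)%N -> d 0 i <= d 0 j) ->
    (forall (i : 'I_n) (w : 'rV[R]_N), w *m X^T = 0 ->
        d 0 i * (w *m w^T) 0 0 <= (w *m A *m w^T) 0 0) ->
    Y *m Y^T = 1%:M ->
  \sum_(i < n) d 0 i <= \tr (Y *m A *m Y^T).
Proof.
move=> As XX XA ds dmin YY.
have [n0|n0] := posnP n; first by subst n; rewrite big_ord0 /mxtrace big_ord0.
pose top : 'I_n := Ordinal
  (eq_ind_r (fun m => (n.-1 < m)%N) (ltnSn _) (esym (prednK n0))).
have dtop i : d 0 i <= d 0 top by apply: ds; rewrite /= -ltnS prednK.
pose C := Y *m X^T; pose P := Y - C *m X.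
have PX : P *m X^T = 0 by rewrite mulmxBl -mulmxA XX mulmx1 subrr.
have AX : A *m X^T = X^T *m diag_mx d.
  by apply: trmx_inj; rewrite !trmx_mul !trmxK As XA tr_diag_mx.
have PAP : P *m A *m P^T = Y *m A *m Y^T - C *m diag_mx d *m C^T.
  have -> : P *m A *m P^T = P *m A *m Y^T.
    rewrite [P^T]linearB /= mulmxBr trmx_mul [P *m A *m (_ *m _)]mulmxA.
    by rewrite -[P *m A *m X^T]mulmxA AX mulmxA PX !mul0mx subr0.
  rewrite 2!mulmxBl; congr (_ - _).
  rewrite -[C *m X *m A]mulmxA XA -!mulmxA; congr (_ *m (_ *m _)).
  by rewrite trmx_mul trmxK.
have PP : P *m P^T = 1%:M - C *m C^T.
  have -> : P *m P^T = P *m Y^T.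
    by rewrite [P^T]linearB /= mulmxBr trmx_mul mulmxA PX mul0mx subr0.
  rewrite mulmxBl YY; congr (_ - _).
  by rewrite -mulmxA; congr (_ *m _); rewrite trmx_mul trmxK.
have trP : d 0 top * \tr (P *m P^T) <= \tr (P *m A *m P^T).
  rewrite /mxtrace mulr_sumr; apply: ler_sum => i _.
  have := dmin top (row i P); rewrite -row_mul PX row0 => /(_ erefl).
  rewrite !mulmx_trE !mxE.
  under eq_bigr do rewrite !mxE.
  under [X in _ <= X -> _]eq_bigr do rewrite !mxE.
  move=> H; apply: le_trans (le_trans _ H) _.
    by rewrite le_eqVlt; apply/orP; left; apply/eqP; congr (_ * _);
      apply: eq_bigr => k _; rewrite !mxE.
  rewrite le_eqVlt; apply/orP; left; apply/eqP; apply: eq_bigr => k _; rewrite !mxE;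
    congr (_ * _).
  by apply: eq_bigr => m _; rewrite !mxE.
have s1 j : (C^T *m C) j j <= 1.
  pose Q := X - C^T *m Y.
  have QQ : Q *m Q^T = 1%:M - C^T *m C.
    have QY : Q *m Y^T = 0.
      by rewrite mulmxBl -mulmxA YY mulmx1 trmx_mul trmxK subrr.
    have -> : Q *m Q^T = Q *m X^T.
      by rewrite [Q^T]linearB /= mulmxBr trmx_mul mulmxA QY mul0mx subr0.
    by rewrite mulmxBl XX -mulmxA.
  have := sqnorm_ge0 _ _ (row j Q).
  have -> : (row j Q *m (row j Q)^T) 0 0 = (Q *m Q^T) j j.
    by rewrite mulmx_trE mxE; apply: eq_bigr => k _; rewrite !mxE.
  by rewrite QQ !mxE eqxx subr_ge0.
have -> : \tr (Y *m A *m Y^T) = \tr (C *m diag_mx d *m C^T) + \tr (P *m A *m P^T).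
  by rewrite PAP mxtraceD raddfN /= addrC subrK.
have -> : \tr (C *m diag_mx d *m C^T) = \sum_j d 0 j * (C^T *m C) j j.
  rewrite mxtrace_mulC mulmxA mxtrace_mulC /mxtrace; apply: eq_bigr => j _.
  by rewrite mul_diag_mx mxE.
apply: (@le_trans _ _ (\sum_j d 0 j * (C^T *m C) j j + d 0 top * \tr (P *m P^T)));
  last by rewrite lerD2l.
have -> : \tr (P *m P^T) = \sum_j (1 - (C^T *m C) j j).
  rewrite PP mxtraceD raddfN /= [\tr (C *m _)]mxtrace_mulC /mxtrace -sumrB.
  by apply: eq_bigr => j _; rewrite mxE eqxx.
rewrite mulr_sumr -big_split /=; apply: ler_sum => j _.
(* d_j t + d_top (1 - t) >= d_j, as t <= 1 and d_j <= d_top. *)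
have := dtop j; have := s1 j; nra.
Qed.

Definition seq_of_row (R : realType) N (v : 'rV[R]_N) (k : nat) : R :=
  oapp (v 0) 0 (insub k).

Lemma seq_of_rowE (R : realType) N (v : 'rV[R]_N) (k : 'I_N) :
  seq_of_row _ _ v k = v 0 k.
Proof. by rewrite /seq_of_row valK. Qed.

(** Sequences instead of vectors, so that truncations of different sizes of one
    infinite matrix can be compared. *)
Lemma galerkin_eigenpairs (R : realType) N n (A : nat -> nat -> R) :
    (forall j k, A j k = A k j) -> (n <= N)%N ->
  exists (x : 'I_n -> nat -> R) (l : 'I_n -> R),
    [/\ forall i j, \sum_(k < N) x i k * x j k = (i == j)%:R,
      forall i (j : nat), (j < N)%N -> \sum_(k < N) A j k * x i k = l i * x i j,
      forall i j : 'I_n, (i <= j)%N -> l i <= l j,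
      forall i k, (N <= k)%N -> x i k = 0 &
      forall y : 'I_n -> nat -> R,
        (forall i j, \sum_(k < N) y i k * y j k = (i == j)%:R) ->
        \sum_i l i <= \sum_i \sum_(j < N) \sum_(k < N) y i j * A j k * y i k].
Proof.
move=> Asym nN.
pose B : 'M[R]_N := \matrix_(j, k) A j k.
have Bs : B^T = B by apply/matrixP => j k; rewrite !mxE Asym.
have [X [d [XX XB ds dmin]]] := exists_lowest_eigenvectors _ _ _ _ Bs nN.
exists (fun i => seq_of_row _ _ (row i X)), (fun i => d 0 i); split=> //.
- move=> i j; have := congr1 (fun M : 'M[R]_n => M i j) XX.
  rewrite !mxE => <-; apply: eq_bigr => k _.
  by rewrite !seq_of_rowE !mxE.
- move=> i j jN; have := congr1 (fun M : 'M[R]_(n, N) => M i (Ordinal jN)) XB.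
  rewrite mul_diag_mx !mxE (seq_of_rowE _ _ _ (Ordinal jN)) mxE => <-.
  by apply: eq_bigr => k _; rewrite seq_of_rowE !mxE Asym mulrC.
- by move=> i k Nk; rewrite /seq_of_row insubN// -leqNgt.
- move=> y yy; pose Y : 'M[R]_(n, N) := \matrix_(i, k) y i k.
  have YY : Y *m Y^T = 1%:M.
    apply/matrixP => i j; rewrite !mxE -yy; apply: eq_bigr => k _.
    by rewrite !mxE.
  apply: le_trans (ky_fan _ _ _ _ _ _ _ Bs XX XB ds dmin YY) _.
  rewrite le_eqVlt; apply/orP; left; apply/eqP; apply: eq_bigr => i _.
  rewrite mxE exchange_big /=; apply: eq_bigr => k _; rewrite !mxE mulr_suml.
  by apply: eq_bigr => j _; rewrite !mxE.
Qed.

(** * The matrix of the form in the cosine basis, and bounds for its eigenpairs *)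

(** The absolute difference, by truncated subtraction. *)
Definition nat_dist (j k : nat) : nat := (j - k + (k - j))%N.

(** The coefficient sequence a stands for the series of the cos_weight k * a k *
    cos(kx); the weight 1/2 at 0 is the ratio of the squared norm of cos(kx), k >=
    1, to that of 1. *)
Definition cos_weight (R : realType) (k : nat) : R := if k == 0%N then 1 / 2 else 1.

(** Up to weights, the matrix of the multiplication by the series with coefficients
    a on the functions cos(kx). *)
Definition mult_coef {R : realType} (a : nat -> R) (j k : nat) : R :=
  (a (nat_dist j k) + a (j + k)%N) / 2.

(** The matrix of the form in the normalised cosines; see the introduction. *)
Definition galerkin {R : realType} (a : nat -> R) (j k : nat) : R :=
  (j == k)%:R * k%:R ^+ 2
  + Num.sqrt (cos_weight R j) * Num.sqrt (cos_weight R k) * mult_coef a j k.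

Lemma nat_distC j k : nat_dist j k = nat_dist k j.
Proof. by rewrite /nat_dist addnC. Qed.

Lemma mult_coefC (R : realType) (a : nat -> R) j k : mult_coef a j k
  = mult_coef a k j.
Proof. by rewrite /mult_coef nat_distC addnC. Qed.

Lemma galerkinC (R : realType) (a : nat -> R) j k : galerkin a j k = galerkin a k j.
Proof.
rewrite /galerkin mult_coefC eq_sym [Num.sqrt _ * _]mulrC; congr (_ + _).
by case: eqP => [->//|_]; rewrite !mul0r.
Qed.

Lemma cos_weight_gt0 (R : realType) k : 0 < cos_weight R k.
Proof. by rewrite /cos_weight; case: ifP => _; lra. Qed.

Lemma cos_weight_le1 (R : realType) k : cos_weight R k <= 1.
Proof. by rewrite /cos_weight; case: ifP => _; lra. Qed.

Lemma sqrt_cos_weight_ge0 (R : realType) k : 0 <= Num.sqrt (cos_weight R k).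
Proof. exact: sqrtr_ge0. Qed.

Lemma sqrt_cos_weight_le1 (R : realType) k : Num.sqrt (cos_weight R k) <= 1.
Proof. by rewrite -[leRHS]sqrtr1 ler_sqrt// ?cos_weight_le1. Qed.

Lemma sqr_sqrt_cos_weight (R : realType) k : Num.sqrt (cos_weight R k)
  * Num.sqrt (cos_weight R k) = cos_weight R k.
Proof. by rewrite -expr2 sqr_sqrtr// ltW// cos_weight_gt0. Qed.

Lemma sum_nat_shift (V : nmodType) (f : nat -> V) p N :
  \sum_(p <= k < p + N) f k = \sum_(0 <= k < N) f (p + k)%N.
Proof.
rewrite -{1}[p]add0n big_addn addKn.
by apply: eq_bigr => i _; rewrite addnC.
Qed.

Lemma sum_shift_le (R : realType) (f : nat -> R) (S : R) p N :
    (forall k, 0 <= f k) -> (forall n, \sum_(0 <= k < n) f k <= S) ->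
  \sum_(0 <= k < N) f (p + k)%N <= S.
Proof.
move=> f0 fS; apply: le_trans (fS (p + N)%N).
rewrite (@big_cat_nat _ _ _ p 0 (p + N)) ?leq_addr//=.
by rewrite (sum_nat_shift _ f p N) lerDr sumr_ge0.
Qed.

(** Each value of the distance to j is taken at most twice. *)
Lemma sum_nat_dist_le (R : realType) (f : nat -> R) (S : R) j N :
    (forall k, 0 <= f k) -> (forall n, \sum_(0 <= k < n) f k <= S) ->
  \sum_(0 <= k < N) f (nat_dist j k) <= S *+ 2.
Proof.
move=> f0 fS; apply: (@le_trans _ _ (\sum_(0 <= k < j + N) f (nat_dist j k))).
  rewrite (@big_cat_nat _ _ _ N 0 (j + N)) ?leq_addl//= lerDl sumr_ge0//.
rewrite (@big_cat_nat _ _ _ j 0 (j + N)) ?leq_addr//= mulr2n lerD//.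
  rewrite big_nat_rev /= big_nat_cond.
  rewrite (eq_bigr (fun i => f (1 + i)%N)); last first.
    by move=> i /andP[/andP[_ ij] _]; congr f; rewrite /nat_dist; lia.
  by rewrite -big_nat_cond; exact: sum_shift_le.
rewrite (sum_nat_shift _ _ j N).
under eq_bigr => i _.
  have -> : nat_dist j (j + i) = i by rewrite /nat_dist; lia.
  over.
exact: fS.
Qed.

(** The Schur bound that makes the multiplication by q a bounded perturbation of the
    diagonal, in the l^1 norm as well as in the l^oo norm. *)
Lemma sum_mult_coef_le (R : realType) (a : nat -> R) (S : R) j N :
    (forall n, \sum_(0 <= k < n) `|a k| <= S) ->
  \sum_(0 <= k < N) `|mult_coef a j k| <= S *+ 2.
Proof.
move=> aS.
have S0 : 0 <= S by have := aS 0%N; rewrite big_geq.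
have h1 := @sum_nat_dist_le R (fun k => `|a k|) S j N (fun k => normr_ge0 _) aS.
have h2 := @sum_shift_le R (fun k => `|a k|) S j N (fun k => normr_ge0 _) aS.
apply: (@le_trans _ _ ((\sum_(0 <= k < N) `|a (nat_dist j k)|
  + \sum_(0 <= k < N) `|a (j + k)%N|) / 2)).
  rewrite -big_split mulr_suml /=; apply: ler_sum => k _.
  by rewrite /mult_coef normrM [`|2^-1|]ger0_norm// ler_wpM2r// ler_normD.
rewrite mulr2n in h1 *; lra.
Qed.

Lemma sum_invsq_le2 (R : realType) N : \sum_(1 <= k < N) (k%:R ^+ 2)^-1 <= 2 :> R.
Proof.
have H n : \sum_(1 <= k < n.+2) (k%:R ^+ 2)^-1 <= 2 - (n.+1%:R)^-1 :> R.
  elim: n => [|n IH]; first by rewrite big_nat1 expr1n invr1; lra.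
  rewrite big_nat_recr//=; apply: le_trans (lerD IH (lexx _)) _.
  have m0 : 0 < n.+1%:R :> R by rewrite ltr0n.
  have -> : n.+2%:R = n.+1%:R + 1 :> R by rewrite -natr1.
  set m := n.+1%:R in m0 *; rewrite -subr_ge0.
  have -> : 2 - (m + 1)^-1 - (2 - m^-1 + ((m + 1) ^+ 2)^-1) = (m * (m + 1) ^+ 2)^-1.
    by field; rewrite !gt_eqF//; lra.
  by rewrite invr_ge0 mulr_ge0 ?sqr_ge0// ltW.
case: N => [|[|n]]; [by rewrite big_geq|by rewrite big_geq|].
by apply: le_trans (H n) _; rewrite gerBl invr_ge0.
Qed.

(** The first part restates the eigenvalue equation in terms of the coefficients c_k
    = s_k x_k of the cosines themselves. The second part is a bootstrap: since |x_k|
    <= 1, the equation bounds k^2 |x_k| by B = L + 2 S, so the l^1 norm of x is at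
    most 1 + 2 B; used once more, the equation bounds the sum of the k^2 |x_k|. The
    bound does not involve N. *)
Lemma eigenvector_l1_bounds (R : realType) (a : nat -> R) (S L l : R) N
  (x : nat -> R) :
    (forall n, \sum_(0 <= k < n) `|a k| <= S) -> `|l| <= L ->
    (forall k, `|x k| <= 1) ->
    (forall j, (j < N)%N -> \sum_(k < N) galerkin a j k * x k = l * x j) ->
  (forall j, (j < N)%N ->
    j%:R ^+ 2 * (Num.sqrt (cos_weight R j) * x j)
     + cos_weight R j * \sum_(0 <= k < N) mult_coef a j k
       * (Num.sqrt (cos_weight R k) * x k)
    = l * (Num.sqrt (cos_weight R j) * x j)) /\
  \sum_(0 <= k < N) k%:R ^+ 2 * `|x k| <= (L + S *+ 2) * (1 + (L + S *+ 2) * 2).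
Proof.
move=> aS lL x1 ev.
have S0 : 0 <= S by have := aS 0%N; rewrite big_geq.
have L0 : 0 <= L by apply: le_trans lL.
have evE j : (j < N)%N -> j%:R ^+ 2 * x j
     + Num.sqrt (cos_weight R j) * \sum_(0 <= k < N) mult_coef a j k
       * (Num.sqrt (cos_weight R k) * x k)
    = l * x j.
  move=> jN; rewrite -(ev _ jN) big_mkord /galerkin.
  under [RHS]eq_bigr do rewrite mulrDl.
  rewrite [RHS]big_split /= mulr_sumr; congr (_ + _); last first.
    by apply: eq_bigr => k _; ring.
  rewrite (bigD1 (Ordinal jN))//= eqxx mul1r big1 ?addr0// => k.
  by rewrite -val_eqE /= eq_sym => /negPf->; rewrite !mul0r.
split=> [j jN|].
  rewrite -[X in X * \sum_(_ <= _ < _) _]sqr_sqrt_cos_weight [l * _]mulrCA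
    -(evE _ jN); ring.
set B := L + S *+ 2.
have B0 : 0 <= B by rewrite addr_ge0// mulrn_wge0.
have cx k : `|Num.sqrt (cos_weight R k) * x k| <= `|x k|.
  by rewrite normrM ger0_norm ?sqrt_cos_weight_ge0// ler_piMl// sqrt_cos_weight_le1.
have evN j : (j < N)%N ->
  j%:R ^+ 2 * `|x j| <= L * `|x j| + \sum_(0 <= k < N) `|mult_coef a j k| * `|x k|.
  move=> jN; have -> : j%:R ^+ 2 * `|x j| = `|j%:R ^+ 2 * x j|
    by rewrite normrM ger0_norm// sqr_ge0.
  have -> := canRL (addrK _) (evE _ jN).
  rewrite (le_trans (ler_normB _ _))// lerD//; first by rewrite normrM ler_wpM2r.
  rewrite normrM ger0_norm ?sqrt_cos_weight_ge0//; apply: le_trans (_ : _ <= 1 * _) _.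
    by apply: ler_wpM2r; rewrite ?sqrt_cos_weight_le1.
  rewrite mul1r (le_trans (ler_norm_sum _ _ _))// ler_sum// => k _.
  by rewrite normrM ler_wpM2l.
(* First use of the equation, with the sup norm of x; the second use, with its l^1
   norm, comes last. *)
have xB j : (j < N)%N -> j%:R ^+ 2 * `|x j| <= B.
  move=> jN; apply: le_trans (evN _ jN) _; apply: lerD; first by rewrite ler_piMr.
  apply: le_trans (@sum_mult_coef_le R a S j N aS); apply: ler_sum => k _.
  by rewrite ler_piMr.
have x1B : \sum_(0 <= k < N) `|x k| <= 1 + B * 2.
  case: N {ev evE evN} xB => [|n] xB; first by rewrite big_geq// addr_ge0// mulr_ge0.
  rewrite big_nat_recl//= lerD//.
  rewrite -[X in X <= _](big_add1 _ _ 0 n.+1 xpredT (fun i => `|x i|)).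
  apply: (@le_trans _ _ (\sum_(1 <= k < n.+1) B * (k%:R ^+ 2)^-1)); last first.
    by rewrite -mulr_sumr ler_wpM2l// sum_invsq_le2.
  apply: ler_sum_nat => k /andP[k1 kn].
  by rewrite ler_pdivlMr ?exprn_gt0 ?ltr0n// mulrC xB.
apply: (@le_trans _ _ (\sum_(0 <= j < N)
  (L * `|x j| + \sum_(0 <= k < N) `|mult_coef a j k| * `|x k|))).
  apply: ler_sum_nat => k /andP[k1 kn]; exact: evN.
rewrite big_split -mulr_sumr /= exchange_big /=.
apply: (@le_trans _ _ (L * \sum_(0 <= k < N) `|x k| + S *+ 2
  * \sum_(0 <= k < N) `|x k|)).
  rewrite lerD2l mulr_sumr; apply: ler_sum => k _.
  rewrite -mulr_suml ler_wpM2r//; under eq_bigr do rewrite mult_coefC;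
    exact: sum_mult_coef_le.
by rewrite -mulrDl ler_wpM2l.
Qed.

(** If l < - 2 S, then the diagonal part k^2 - l exceeds 2 S, while the l^1 norm of
    the perturbation of x is at most 2 S times that of x. *)
Lemma eigenvalue_ge (R : realType) (a : nat -> R) (S l : R) N (x : nat -> R) :
    (forall n, \sum_(0 <= k < n) `|a k| <= S) ->
    \sum_(k < N) x k * x k = 1 ->
    (forall j, (j < N)%N -> \sum_(k < N) galerkin a j k * x k = l * x j) ->
  - (S *+ 2) <= l.
Proof.
move=> aS x1 ev; rewrite leNgt; apply/negP => lS.
have S0 : 0 <= S by have := aS 0%N; rewrite big_geq.
have evE j : (j < N)%N ->
  (j%:R ^+ 2 - l) * `|x j| <= \sum_(0 <= k < N) `|mult_coef a j k| * `|x k|.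
  move=> jN; have d0 : 0 <= j%:R ^+ 2 - l
    by rewrite subr_ge0 (le_trans _ (sqr_ge0 _))// ltW// (lt_le_trans lS)// oppr_le0
    mulrn_wge0.
  rewrite -[X in X * _](ger0_norm d0) -normrM.
  have -> : (j%:R ^+ 2 - l) * x j = - (Num.sqrt (cos_weight R j) *
      \sum_(0 <= k < N) mult_coef a j k * (Num.sqrt (cos_weight R k) * x k)).
    rewrite mulrBl -(ev _ jN) big_mkord /galerkin.
    under eq_bigr do rewrite mulrDl.
    rewrite big_split /= (bigD1 (Ordinal jN))//= eqxx mul1r big1 ?addr0; last first.
      by move=> k; rewrite -val_eqE /= eq_sym => /negPf->; rewrite !mul0r.
    rewrite opprD addrA subrr add0r; congr (- _); rewrite mulr_sumr.
    by apply: eq_bigr => k _; ring.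
  rewrite normrN normrM ger0_norm ?sqrt_cos_weight_ge0//;
    apply: le_trans (_ : _ <= 1 * _) _.
    by apply: ler_wpM2r; rewrite ?sqrt_cos_weight_le1.
  rewrite mul1r (le_trans (ler_norm_sum _ _ _))// ler_sum// => k _.
  by rewrite normrM ler_wpM2l// normrM ger0_norm ?sqrt_cos_weight_ge0// ler_piMl//
    sqrt_cos_weight_le1.
pose X := \sum_(0 <= k < N) `|x k|.
have X0 : 0 < X.
  rewrite lt_neqAle sumr_ge0// andbT eq_sym; apply/eqP;
    rewrite /X big_mkord => /psumr_eq0P h.
  move: x1; rewrite big1 => [/eqP|k _]; first by rewrite eq_sym oner_eq0.
  by have /eqP := h (fun i _ => normr_ge0 _) k isT; rewrite normr_eq0 => /eqP->;
    rewrite mul0r.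
have h1 : - l * X <= S *+ 2 * X.
  apply: (@le_trans _ _ (\sum_(0 <= j < N) \sum_(0 <= k < N) `|mult_coef a j k|
    * `|x k|)).
    rewrite mulr_sumr; apply: ler_sum_nat => k /andP[_ kN];
      apply: le_trans (evE _ kN).
    by rewrite ler_wpM2r// lerDr sqr_ge0.
  rewrite exchange_big mulr_sumr /=; apply: ler_sum => k _.
  rewrite -mulr_suml ler_wpM2r//; under eq_bigr do rewrite mult_coefC;
    exact: sum_mult_coef_le.
move: h1; rewrite ler_pM2r//; lra.
Qed.

Lemma sum_delta_row (R : realType) N i (f : nat -> R) : (i < N)%N ->
  \sum_(k < N) (i == k :> nat)%:R * f k = f i.
Proof.
move=> iN; rewrite (bigD1 (Ordinal iN))//= eqxx mul1r big1 ?addr0// => k.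
by rewrite -val_eqE /= eq_sym => /negPf->; rewrite mul0r.
Qed.

(** Uniformly in the size N: from below by the Schur bound, from above because Ky
    Fan's inequality, applied to the first n basis vectors, bounds the sum of the
    eigenvalues. *)
Lemma galerkin_eigenvalues_bounded (R : realType) (a : nat -> R) (S : R) n :
    (forall n, \sum_(0 <= k < n) `|a k| <= S) ->
  exists L, forall N (x : 'I_n -> nat -> R) (l : 'I_n -> R), (n <= N)%N ->
    (forall i j, \sum_(k < N) x i k * x j k = (i == j)%:R) ->
    (forall i (j : nat), (j < N)%N ->
      \sum_(k < N) galerkin a j k * x i k = l i * x i j) ->
    (forall y : 'I_n -> nat -> R,
        (forall i j, \sum_(k < N) y i k * y j k = (i == j)%:R) ->
        \sum_i l i <= \sum_i \sum_(j < N) \sum_(k < N) y i j * galerkin a j k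
          * y i k) ->
    forall i, `|l i| <= L.
Proof.
move=> aS; exists (\sum_(i < n) `|galerkin a i i| + S *+ 2 *+ n) =>
  N x l nN xx ev lmin i.
have S0 : 0 <= S by have := aS 0%N; rewrite big_geq.
have lS j : - (S *+ 2) <= l j.
  by apply: eigenvalue_ge aS _ (ev j); rewrite xx eqxx.
have := lmin (fun i k => (i == k :> nat)%:R).
have H (p q : 'I_n) : \sum_(k < N) (p == k :> nat)%:R * (q == k :> nat)%:R
  = (p == q)%:R :> R.
  by rewrite (sum_delta_row _ N p (fun k => (q == k :> nat)%:R))
    ?(leq_trans (ltn_ord p))// eq_sym.
move=> /(_ H).
under [X in _ <= X -> _]eq_bigr => p _.
  under eq_bigr => j _.
    under eq_bigr do rewrite -mulrA.
    rewrite -mulr_sumr; under eq_bigr do rewrite mulrC.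
    rewrite (sum_delta_row _ N p (fun k => galerkin a j k))
      ?(leq_trans (ltn_ord p))//.
    over.
  rewrite (sum_delta_row _ N p (fun k => galerkin a k p)) ?(leq_trans (ltn_ord p))//.
  over.
move=> /= lD.
have n0 : (0 < n)%N by exact: leq_ltn_trans (ltn_ord i).
have ge0 : 0 <= \sum_(i < n) `|galerkin a i i| by exact: sumr_ge0.
have Sn : S *+ 2 <= S *+ 2 *+ n.
  by rewrite -(prednK n0) [leRHS]mulrSr lerDr !mulrn_wge0.
rewrite ler_norml; apply/andP; split.
  by apply: le_trans (lS i); rewrite lerN2; apply: (le_trans Sn); rewrite lerDr.
have : \sum_(j < n) (l j + S *+ 2) <= \sum_(i < n) `|galerkin a i i| + S *+ 2 *+ n.
  rewrite big_split /= sumr_const card_ord lerD2r (le_trans lD)// ler_sum// => j _.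
  exact: ler_norm.
apply: le_trans; rewrite (bigD1 i)//= -addrA lerDl addr_ge0 ?mulrn_wge0//.
by apply: sumr_ge0 => j _; rewrite -lerBlDr sub0r.
Qed.

(** * Multiplication by the potential on cosine polynomials *)

Definition cos_sum {R : realType} (a : nat -> R) (M : nat) (x : R) : R :=
  \sum_(0 <= i < M) cos_weight R i * a i * cos (i%:R * x).

(** The partial sum of the cosine expansion of q(x) cos(kx), for q with coefficients
    a. *)
Definition mult_sum {R : realType} (a : nat -> R) (k J : nat) (x : R) : R :=
  \sum_(0 <= j < J) cos_weight R j * mult_coef a j k * cos (j%:R * x).

Lemma cos_mul_cos (R : realType) (s t : R) :
  cos s * cos t = (cos (s + t) + cos (s - t)) / 2.
Proof. by rewrite cosD cosB; field. Qed.

(** The partial sum of length M + 1 + k contains the whole product with cos(kx) of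
    the terms of q of index at most M; only the terms of index between M + 1 and M +
    2 k are cut. *)
Lemma mult_sumE (R : realType) (a : nat -> R) k M x :
  mult_sum a k (M.+1 + k) x = cos_sum a M.+1 x * cos (k%:R * x)
    + \sum_(M.+1 <= i < M.+1 + k + k) a i / 2 * cos ((i%:R - k%:R) * x).
Proof.
elim: M => [|M IH].
  pose f i := a i / 2 * cos ((i%:R - k%:R) * x).
  have -> : cos_sum a 1 x * cos (k%:R * x) = f 0%N.
    rewrite /cos_sum big_nat1 /cos_weight eqxx mul0r cos0 /f sub0r mulNr cosN;
      by field.
  rewrite (_ : f 0%N + _ = \sum_(0 <= i < k.+1 + k) f i); last first.
    by rewrite [RHS]big_ltn // add1n.
  rewrite (@big_cat_nat _ _ _ k 0 (k.+1 + k)) /= ?leqW ?leq_addr//.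
  rewrite [X in _ + X]big_ltn ?leq_addr// ?(sum_nat_shift _ _ k.+1 k).
  rewrite /mult_sum add1n big_nat_recl// addrCA; congr (_ + _).
    rewrite /cos_weight eqxx mul0r cos0 /f subrr mul0r cos0 /mult_coef /nat_dist
      sub0n subn0 !add0n; by field.
  rewrite [X in _ = X + _]big_nat_rev -big_split /=.
  apply: eq_big_nat => i /andP[_ ik].
  rewrite /f /mult_coef /nat_dist /cos_weight /= add0n.
  rewrite (_ : i.+1 - k + (k - i.+1) = k - i.+1)%N; last by lia.
  rewrite (_ : i.+1 + k = k.+1 + i)%N; last by lia.
  rewrite natrB// (_ : (k%:R - i.+1%:R - k%:R) * x = - (i.+1%:R * x)); last by ring.
  rewrite cosN (_ : ((k.+1 + i)%:R - k%:R) * x = i.+1%:R * x); first by field.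
  by rewrite addSnnS natrD; ring.
have -> : mult_sum a k (M.+2 + k) x = mult_sum a k (M.+1 + k) x +
   cos_weight R (M.+1 + k) * mult_coef a (M.+1 + k) k * cos ((M.+1 + k)%:R * x).
  by rewrite /mult_sum addSn big_nat_recr.
have -> : cos_sum a M.+2 x = cos_sum a M.+1 x + cos_weight R M.+1 * a M.+1
  * cos (M.+1%:R * x).
  by rewrite /cos_sum big_nat_recr.
pose f i := a i / 2 * cos ((i%:R - k%:R) * x).
have : \sum_(M.+1 <= i < M.+1 + k + k) f i + f (M.+1 + k + k)%N =
    f M.+1 + \sum_(M.+2 <= i < M.+2 + k + k) f i.
  by rewrite -big_nat_recr/= -?addnA ?leq_addr// -big_ltn// ltnS leq_addr.
move=> /(canRL (addrK _)); rewrite IH => ->; rewrite -/f {}/f.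
rewrite /mult_coef /nat_dist /cos_weight /=.
rewrite (_ : M.+1 + k - k + _ = M.+1)%N; last by lia.
rewrite (_ : (cos_sum a M.+1 x + 1 * a M.+1 * cos (M.+1%:R * x)) * cos (k%:R * x) =
  cos_sum a M.+1 x * cos (k%:R * x)
  + a M.+1 * (cos (M.+1%:R * x) * cos (k%:R * x))); last by ring.
rewrite cos_mul_cos !natrD.
rewrite (_ : M.+1%:R * x + k%:R * x = (M.+1%:R + k%:R) * x); last by ring.
rewrite (_ : M.+1%:R * x - k%:R * x = (M.+1%:R - k%:R) * x); last by ring.
rewrite (_ : (M.+1%:R + k%:R + k%:R - k%:R) * x = (M.+1%:R + k%:R) * x); last by ring.
by field.
Qed.

Lemma mult_sum_le (R : realType) (a : nat -> R) (S : R) k J x :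
    (forall n, \sum_(0 <= k < n) `|a k| <= S) ->
  `|mult_sum a k J x| <= S *+ 2.
Proof.
move=> aS; rewrite (le_trans (ler_norm_sum _ _ _))//.
apply: le_trans (@sum_mult_coef_le _ a S k J aS).
apply: ler_sum => j _; rewrite normrM [`|cos_weight R j * _|]normrM
  (ger0_norm (ltW (cos_weight_gt0 _ _))) -[leRHS]mulr1.
rewrite mult_coefC ler_pM ?mulr_ge0 ?(ltW (cos_weight_gt0 _ _))// ?cos_max//.
by rewrite ler_piMl// cos_weight_le1.
Qed.

Lemma mult_sum_approx (R : realType) (a : nat -> R) (S tau q : R) k M x :
    (forall n, \sum_(0 <= i < n) `|a i| <= S) ->
    (forall n, \sum_(M.+1 <= i < n) `|a i| <= tau) ->
    `|q - cos_sum a M.+1 x| <= tau ->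
  `|q * cos (k%:R * x) - mult_sum a k (M.+1 + k) x| <= tau *+ 2.
Proof.
move=> aS atau qtau.
rewrite mult_sumE opprD addrA -mulrBl mulr2n (le_trans (ler_normB _ _))// lerD//.
  by rewrite normrM -[leRHS]mulr1 ler_pM ?cos_max.
rewrite (le_trans (ler_norm_sum _ _ _))//; apply: le_trans (atau (M.+1 + k + k)%N).
apply: ler_sum => i _; rewrite !normrM -mulrA ler_piMr// -[leRHS]mulr1.
by rewrite ler_pM ?cos_max// ger0_norm ?invr_ge0// invf_le1// lerDl.
Qed.

(** The left-hand side is |- u'' + q u - l u| at x, for u the cosine polynomial with
    coefficients c. By the equations satisfied by c it is the truncation error of
    the expansion of q u. For k < K that error is governed by the tail of the
    coefficients of q beyond N - K; for k >= K by the decay of c. *)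
Lemma residual_bound (R : realType) (a : nat -> R) (S C tau q l x : R) K N c :
    (forall n, \sum_(0 <= i < n) `|a i| <= S) ->
    (forall n, \sum_(N - K <= i < n) `|a i| <= tau) ->
    (forall M, (N - K <= M)%N -> `|q - cos_sum a M x| <= tau) ->
    `|q| <= S ->
    (0 < K <= N)%N ->
    \sum_(0 <= k < N) `|c k| <= C ->
    \sum_(0 <= k < N) k%:R ^+ 2 * `|c k| <= C ->
    (forall j, (j < N)%N -> j%:R ^+ 2 * c j
      + cos_weight R j * \sum_(0 <= k < N) mult_coef a j k * c k = l * c j) ->
  `|\sum_(0 <= k < N) k%:R ^+ 2 * c k * cos (k%:R * x)
    + q * (\sum_(0 <= k < N) c k * cos (k%:R * x))
    - l * (\sum_(0 <= k < N) c k * cos (k%:R * x))| <= C * (tau *+ 2 + S *+ 3 / K%:R).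
Proof.
move=> aS atau qtau qS /andP[K0 KN] cC c2C ev.
have S0 : 0 <= S by have := aS 0%N; rewrite big_geq.
have tau0 : 0 <= tau by have := atau 0%N; rewrite big_geq.
have -> : \sum_(0 <= k < N) k%:R ^+ 2 * c k * cos (k%:R * x)
    + q * (\sum_(0 <= k < N) c k * cos (k%:R * x))
    - l * (\sum_(0 <= k < N) c k * cos (k%:R * x)) =
   \sum_(0 <= k < N) c k * (q * cos (k%:R * x) - mult_sum a k N x).
  have -> : l * (\sum_(0 <= k < N) c k * cos (k%:R * x)) =
     \sum_(0 <= k < N) k%:R ^+ 2 * c k * cos (k%:R * x) + \sum_(0 <= k < N) c k
       * mult_sum a k N x.
    rewrite mulr_sumr.
    under eq_big_nat => j /andP[_ jN] do rewrite mulrA -(ev _ jN) mulrDl.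
    rewrite big_split /=; congr (_ + _).
    under [RHS]eq_bigr do rewrite mulr_sumr.
    rewrite exchange_big /=; apply: eq_bigr => j _.
    by rewrite mulrAC mulr_sumr; apply: eq_bigr => k _; ring.
  rewrite mulr_sumr opprD addrACA subrr add0r -sumrB.
  by apply: eq_bigr => k _; ring.
rewrite (le_trans (ler_norm_sum _ _ _))// mulrDr.
rewrite (@big_cat_nat _ _ _ K) //= lerD//.
  apply: (@le_trans _ _ (\sum_(0 <= k < K) `|c k| * (tau *+ 2))).
    apply: ler_sum_nat => k /andP[_ kK]; rewrite normrM ler_wpM2l//.
    have kN : (k < N)%N by exact: leq_trans KN.
    rewrite -(subnK kN) addnS -addSn; apply: mult_sum_approx aS _ _.
      move=> n; apply: le_trans (atau n).
      have [nM|nM] := leqP n (N - k.+1).+1; first by rewrite big_geq// sumr_ge0.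
      by rewrite [leRHS](@big_cat_nat _ _ _ (N - k.+1).+1)/=;
        [rewrite lerDr sumr_ge0|lia|lia].
    by apply: qtau; lia.
  rewrite -mulr_suml ler_wpM2r ?mulrn_wge0//; apply: le_trans cC.
  by rewrite [leRHS](@big_cat_nat _ _ _ K)//= lerDl sumr_ge0.
have K0R : 0 < K%:R :> R by rewrite ltr0n.
apply: (@le_trans _ _ (\sum_(K <= k < N) k%:R ^+ 2 * `|c k| * (S *+ 3 / K%:R))).
  apply: ler_sum_nat => k /andP[kK _]; rewrite normrM.
  have -> : k%:R ^+ 2 * `|c k| * (S *+ 3 / K%:R) = `|c k|
    * ((k%:R ^+ 2 / K%:R) * S *+ 3) by ring.
  rewrite ler_wpM2l//; apply: (@le_trans _ _ (S *+ 3)).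
    rewrite mulrS (le_trans (ler_normB _ _))// lerD//; last exact: mult_sum_le.
    by rewrite normrM -[leRHS]mulr1 ler_pM ?cos_max.
  rewrite lerMn2r /=; rewrite ler_peMl// ler_pdivlMr// mul1r.
  have kK' : K%:R <= k%:R :> R by rewrite ler_nat.
  have K1 : 1 <= K%:R :> R by rewrite ler1n.
  nra.
rewrite -mulr_suml ler_wpM2r ?mulr_ge0 ?mulrn_wge0 ?invr_ge0 ?(ltW K0R)//.
apply: le_trans c2C.
by rewrite [leRHS](@big_cat_nat _ _ _ K)//= lerDr sumr_ge0// => k _;
  rewrite mulr_ge0// sqr_ge0.
Qed.

(** * Uniform limits along an ultrafilter *)

Lemma ultra_cvg {R : realType} (U : set_system nat) (UU : UltraFilter U)
    (f : nat -> R) (B : R) :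
  (forall m, `|f m| <= B) -> cvg (f @ U).
Proof.
move=> fB.
have [|p [_ clp]] := (@segment_compact R (- B) B) (f @ U) _.
  by apply: (@filterE _ U _ (fun m => `[- B, B]%classic (f m))) => m /=;
    rewrite in_itv /= -ler_norml.
apply/cvg_ex; exists p => A nA.
have [//|nfA] := in_ultra_setVsetC (f @^-1` A) UU.
have [x [nx Ax]] := clp (~` A) A nfA nA.
by [].
Qed.

Lemma near_forall_lt (U : set_system nat) (FU : Filter U) (P : nat -> nat -> Prop) K :
  (forall k, \forall m \near U, P k m) ->
  \forall m \near U, forall k, (k < K)%N -> P k m.
Proof.
move=> H; elim: K => [|K IH]; first by apply: filterE.
near=> m => k; rewrite ltnS leq_eqVlt => /orP[/eqP->|].
  by near: m; exact: H.
by move: k; near: m.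
Unshelve. all: by end_near. Qed.

(** In the tail the weight k is at least K. *)
Lemma sum_tail_le (R : realType) (t c : nat -> R) (C : R) K N :
    (forall k, `|t k| <= 1) -> (0 < K <= N)%N ->
    \sum_(0 <= k < N) k%:R * `|c k| <= C ->
  `|\sum_(0 <= k < N) c k * t k - \sum_(0 <= k < K) c k * t k| <= C / K%:R.
Proof.
move=> t1 /andP[K0 KN] cC.
have K0R : 0 < K%:R :> R by rewrite ltr0n.
rewrite (@big_cat_nat _ _ _ K 0 N)//= addrAC subrr add0r
  (le_trans (ler_norm_sum _ _ _))//.
rewrite ler_pdivlMr// mulr_suml; apply: le_trans cC.
rewrite [leRHS](@big_cat_nat _ _ _ K 0 N)//= -[leLHS]add0r lerD//.
  by apply: sumr_ge0 => k _; rewrite mulr_ge0.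
apply: ler_sum_nat => k /andP[Kk _]; rewrite normrM mulrC ler_pM ?ler_nat//.
by rewrite ler_piMr.
Qed.

(** A bounded real sequence converges along an ultrafilter, so the coefficients
    converge one by one; the weighted l^1 bound makes the tails uniformly small.
    Hence the partial sums are uniformly Cauchy along the ultrafilter. *)
Lemma ultra_unif_lim (R : realType) (U : set_system nat) (UU : UltraFilter U)
    (N : nat -> nat) (c : nat -> nat -> R) (t : nat -> R -> R) (C : R) :
    (forall K, \forall m \near U, (K <= N m)%N) ->
    (forall k x, `|t k x| <= 1) ->
    (forall m k, `|c m k| <= C) ->
    (forall m, \sum_(0 <= k < N m) k%:R * `|c m k| <= C) ->
  exists g : R -> R, forall e : R, 0 < e ->
    \forall m \near U, forall x,
      `|\sum_(0 <= k < N m) c m k * t k x - g x| <= e.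
Proof.
move=> NU t1 cC kcC.
have C0 : 0 <= C by apply: le_trans (cC 0%N 0%N).
pose G m x := \sum_(0 <= k < N m) c m k * t k x.
have GC m x : `|G m x| <= C + C.
  rewrite /G; case: (N m) (kcC m) => [|n] kc;
    first by rewrite big_geq// normr0 addr_ge0.
  have := @sum_tail_le R (t ^~ x) (c m) C 1 n.+1 (t1 ^~ x) isT kc.
  rewrite big_nat1 divr1 => h.
  rewrite -[X in `|X|](subrK (c m 0%N * t 0%N x)) (le_trans (ler_normD _ _))// lerD//.
  by rewrite normrM (le_trans _ (cC m 0%N))// ler_piMr.
have Gcvg x : cvg (G ^~ x @ U) := ultra_cvg U UU _ _ (GC ^~ x).
have ccvg k : cvg (c ^~ k @ U) := ultra_cvg U UU _ _ (cC ^~ k).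
exists (fun x => lim (G ^~ x @ U)) => e e0.
pose K := (Num.truncn (8 * C / e)).+1.
have K0R : 0 < K%:R :> R by rewrite ltr0n.
have CK : C / K%:R <= e / 8.
  rewrite ler_pdivrMr//; have : 8 * C / e < K%:R by exact: truncnS_gt.
  rewrite ltr_pdivrMr// => h; lra.
pose d := e / 8 / K%:R.
have d0 : 0 < d by rewrite !divr_gt0.
have E1 : \forall m \near U, (K <= N m)%N /\ forall k, (k < K)%N ->
  `|lim (c ^~ k @ U) - c m k| <= d.
  apply: filterI; first exact: NU.
  apply: near_forall_lt => k.
  by move/cvgrPdist_le : (ccvg k); apply.
(* Both sums are compared with their first K terms; each tail is at most e / 8. *)
have close m m' x : (K <= N m)%N /\
  (forall k, (k < K)%N -> `|lim (c ^~ k @ U) - c m k| <= d) ->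
  (K <= N m')%N /\ (forall k, (k < K)%N -> `|lim (c ^~ k @ U) - c m' k| <= d) ->
  `|G m x - G m' x| <= e / 2.
  move=> [Km cm] [Km' cm'].
  pose H m := \sum_(0 <= k < K) c m k * t k x.
  have HH : `|H m - H m'| <= e / 4.
    rewrite /H -sumrB (le_trans (ler_norm_sum _ _ _))//.
    apply: (@le_trans _ _ (\sum_(0 <= k < K) (d *+ 2))).
      apply: ler_sum_nat => k /andP[_ kK]; rewrite -mulrBl normrM.
      apply: (@le_trans _ _ `|c m k - c m' k|); first by rewrite ler_piMr.
      have -> : c m k - c m' k = (lim (c ^~ k @ U) - c m' k)
        - (lim (c ^~ k @ U) - c m k) by ring.
      by rewrite (le_trans (ler_normB _ _))// mulr2n lerD// ?cm ?cm'.
    rewrite big_mkord sumr_const card_ord -[_ *+ K]mulr_natr /d.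
    have -> : (e / 8 / K%:R) *+ 2 * K%:R = e / 4 by field; rewrite gt_eqF.
    by [].
  have h1 := @sum_tail_le R (t ^~ x) (c m) C K (N m) (t1 ^~ x) Km (kcC m).
  have h2 := @sum_tail_le R (t ^~ x) (c m') C K (N m') (t1 ^~ x) Km' (kcC m').
  rewrite -/(G m x) -/(H m) in h1; rewrite -/(G m' x) -/(H m') in h2.
  have -> : G m x - G m' x = (G m x - H m) - (G m' x - H m') + (H m - H m') by ring.
  rewrite (le_trans (ler_normD _ _))//;
    have := ler_normB (G m x - H m) (G m' x - H m').
  move: h1 h2 CK HH; lra.
near=> m => x.
have E2 : \forall m' \near U, `|lim (G ^~ x @ U) - G m' x| <= e / 2.
  by move/cvgrPdist_le : (Gcvg x); apply; rewrite divr_gt0.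
have [m' [Em' Gm']] := filter_ex (filterI E1 E2).
have Em : (K <= N m)%N /\ (forall k, (k < K)%N -> `|lim (c ^~ k @ U) - c m k| <= d).
  by near: m.
rewrite -/(G m x).
have -> : G m x - lim (G ^~ x @ U) = (G m x - G m' x) - (lim (G ^~ x @ U) - G m' x)
  by ring.
have := close m m' x Em Em';
  have := ler_normB (G m x - G m' x) (lim (G ^~ x @ U) - G m' x).
move: Gm'; lra.
Unshelve. all: by end_near. Qed.

(** * Bounded and integrable functions on the interval *)

(** Multipliers of integrable functions on the interval; every function built below
    from q, cosine polynomials and their limits is of this kind. *)
Definition bounded_mfun {R : realType} (f : R -> R) : Prop :=
  measurable_fun (itv0pi : set (measurableTypeR R)) f /\
  exists C : R, forall x, itv0pi x -> `|f x| <= C.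

Definition integrable0pi {R : realType} (f : R -> R) : Prop :=
  (@lebesgue_measure R).-integrable itv0pi (EFin \o f).

Definition integral0pi {R : realType} (f : R -> R) : R :=
  \int[@lebesgue_measure R]_(x in itv0pi) f x.

Section integral0pi.
Variable R : realType.
Implicit Types (f g w : R -> R).

Lemma measurable_itv0pi : measurable (itv0pi : set (measurableTypeR R)).
Proof. exact: measurable_itv. Qed.
Local Hint Resolve measurable_itv0pi : core.

Lemma itv0pi_finite : (lebesgue_measure (itv0pi : set R) < +oo)%E.
Proof. by rewrite lebesgue_measure_itv/=; case: ifP => _; rewrite ltry. Qed.

Lemma continuous_bounded_mfun f : continuous f -> bounded_mfun f.
Proof.
move=> cf; split; first by apply: measurable_funTS;
  exact: measurable_realfun.continuous_measurable_fun.
have cf' : {within `[0, pi], continuous f} by exact: continuous_subspaceT.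
have [c _ cmax] := EVT_max (@pi_ge0 R) cf'.
have [d _ dmin] := EVT_min (@pi_ge0 R) cf'.
exists (`|f c| + `|f d|) => x /subset_itv_oo_cc xI; rewrite ler_norml; apply/andP;
  split.
  apply: le_trans (dmin x xI); rewrite lerNl; apply: (le_trans (ler_norm _)).
  by rewrite normrN lerDr.
by apply: le_trans (cmax x xI) _; apply: (le_trans (ler_norm _)); rewrite lerDl.
Qed.

Lemma bounded_mfunM f g : bounded_mfun f -> bounded_mfun g ->
  bounded_mfun (fun x => f x * g x).
Proof.
move=> [mf [C fC]] [mg [D gD]]; split;
  first exact: measurable_realfun.measurable_funM.
by exists (C * D) => x Ix; rewrite normrM ler_pM ?fC ?gD.
Qed.

Lemma bounded_mfunD f g : bounded_mfun f -> bounded_mfun g ->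
  bounded_mfun (fun x => f x + g x).
Proof.
move=> [mf [C fC]] [mg [D gD]]; split;
  first exact: measurable_realfun.measurable_funD.
by exists (C + D) => x Ix; rewrite (le_trans (ler_normD _ _))// lerD ?fC ?gD.
Qed.

Lemma bounded_mfun_cst (c : R) : bounded_mfun (fun=> c).
Proof. by split => //; exists `|c|. Qed.

Lemma bounded_mfunN f : bounded_mfun f -> bounded_mfun (fun x => - f x).
Proof.
move=> /(bounded_mfunM _ _ (bounded_mfun_cst (-1))); congr bounded_mfun.
by apply/funext => x; rewrite mulN1r.
Qed.

Lemma bounded_mfunB f g : bounded_mfun f -> bounded_mfun g ->
  bounded_mfun (fun x => f x - g x).
Proof. by move=> bf bg; apply: bounded_mfunD => //; exact: bounded_mfunN. Qed.

Lemma bounded_mfun_unif_lim (f : nat -> R -> R) g :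
    (forall m, bounded_mfun (f m)) ->
    (forall e : R, 0 < e -> exists m, forall x, itv0pi x -> `|f m x - g x| <= e) ->
  bounded_mfun g.
Proof.
move=> bf fg; split.
  have [s sP] : {s : nat -> nat & forall n x, itv0pi x ->
    `|f (s n) x - g x| <= n.+1%:R^-1}.
    by apply: (@choice _ _ (fun n m => forall x, itv0pi x ->
      `|f m x - g x| <= n.+1%:R^-1)) => n;
      apply: fg; rewrite invr_gt0.
  apply: (@measurable_realfun.measurable_fun_cvg _ _ R itv0pi (f \o s)) => [m|x Ix].
    exact: (bf (s m)).1.
  apply/cvgrPdist_le => e e0; near=> n.
  rewrite distrC (le_trans (sP n x Ix))//.
  apply/ltW; near: n; exact: (near_infty_natSinv_lt (PosNum e0)).
have [m mP] := fg 1 ltr01; have [C fC] := (bf m).2.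
exists (C + 1) => x Ix; rewrite -[g x](subKr (f m x)).
by rewrite (le_trans (ler_normB _ _))// lerD ?fC ?mP.
Unshelve. all: by end_near. Qed.

Lemma integrable0piM f w : bounded_mfun f -> integrable0pi w ->
  integrable0pi (fun x => f x * w x).
Proof.
move=> [mf [C fC]] iw.
have bd : [bounded f x | x in (itv0pi : set R)].
  exists C; split; first exact: num_real.
  by move=> D CD x /fC /le_trans; apply; exact: ltW.
have h := integrableMr measurable_itv0pi mf bd iw.
by rewrite /integrable0pi; apply: (eq_integrable measurable_itv0pi _ _ _ h).
Qed.

Lemma bounded_mfun_integrable f : bounded_mfun f -> integrable0pi f.
Proof.
move=> [mf [C fC]]; apply: measurable_bounded_integrable => //.
  exact: itv0pi_finite.
exists C; split; first exact: num_real.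
by move=> D CD x /fC /le_trans; apply; exact: ltW.
Qed.

Lemma bounded_mfun_L2 f : bounded_mfun f -> L2 f.
Proof.
move=> bf; rewrite /L2 inE; apply/andP; split; rewrite inE/=.
  apply/(measurable_restrictT _ _).1 => //; exact: bf.1.
rewrite /finite_norm unlock poweR_lty//.
have ff : integrable0pi (fun x => f x * f x) by apply: bounded_mfun_integrable;
  exact: bounded_mfunM.
have := integrable_lty measurableT ((integrable_mkcond _ measurable_itv0pi).1 ff).
apply: le_lt_trans; rewrite le_eqVlt; apply/orP; left; apply/eqP.
apply: eq_integral => x _ /=; rewrite !patchE /=; case: ifP => _ /=.
  by rewrite powR_mulrn// real_normK ?num_real// expr2.
by rewrite normr0 powR0// pnatr_eq0.
Qed.

(** Square integrable functions are integrable, the interval being of finite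
    measure. *)
Lemma L2_integrable0pi f : L2 f -> integrable0pi f.
Proof.
move=> f2; have := Lfun2_mul_Lfun1 f2 (bounded_mfun_L2 _ (bounded_mfun_cst 1)).
move=> /Lfun1_integrable h; apply/integrable_mkcond => //.
apply: eq_integrable h => // x _ /=; rewrite !patchE /=.
by case: ifP => _ /=; rewrite ?mulr1 ?mulr0.
Qed.

Lemma integrable0piD f g : integrable0pi f -> integrable0pi g ->
  integrable0pi (fun x => f x + g x).
Proof. move=> fi gi; have h := integrableD measurable_itv0pi fi gi.
by rewrite /integrable0pi; apply: (eq_integrable measurable_itv0pi _ _ _ h). Qed.

Lemma integrable0piZ (c : R) f : integrable0pi f -> integrable0pi (fun x => c * f x).
Proof. by move=> fi; apply: integrable0piM => //; exact: bounded_mfun_cst. Qed.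

Lemma eq_integral0pi f g : (forall x, itv0pi x -> f x = g x) ->
  integral0pi f = integral0pi g.
Proof. by move=> fg; apply: eq_Rintegral => x /set_mem /fg. Qed.

Lemma integral0piD f g : integrable0pi f -> integrable0pi g ->
  integral0pi (fun x => f x + g x) = integral0pi f + integral0pi g.
Proof. by move=> fi gi; exact: RintegralD. Qed.

Lemma integral0piZ (c : R) f : integrable0pi f ->
  integral0pi (fun x => c * f x) = c * integral0pi f.
Proof. by move=> fi; exact: RintegralZl. Qed.

Lemma integrable0pi_sum I (r : seq I) (f : I -> R -> R) :
  (forall i, integrable0pi (f i)) ->
  integrable0pi (fun x => \sum_(i <- r) f i x).
Proof.
move=> fi; elim: r => [|i r IH].
  under eq_fun do rewrite big_nil;
    exact: bounded_mfun_integrable (bounded_mfun_cst 0).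
by under eq_fun do rewrite big_cons; exact: integrable0piD.
Qed.

Lemma integral0pi_sum I (r : seq I) (f : I -> R -> R) :
  (forall i, integrable0pi (f i)) ->
  integral0pi (fun x => \sum_(i <- r) f i x) = \sum_(i <- r) integral0pi (f i).
Proof.
move=> fi; elim: r => [|i r IH].
  rewrite big_nil; under eq_fun do rewrite big_nil.
  by rewrite /integral0pi Rintegral_cst// ?mul0r.
under eq_fun do rewrite big_cons; rewrite big_cons integral0piD ?IH//.
exact: integrable0pi_sum.
Qed.

Lemma norm_integral0pi_le f (C : R) w : bounded_mfun f -> integrable0pi w ->
    (forall x, itv0pi x -> `|f x| <= C) ->
  `|integral0pi (fun x => f x * w x)| <= C * integral0pi (fun x => `|w x|).
Proof.
move=> bf iw fC.
have iaw : integrable0pi (fun x => `|w x|) by exact: integrable_norm.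
have ifw := integrable0piM _ _ bf iw.
rewrite -integral0piZ//; apply: le_trans (le_normr_Rintegral measurable_itv0pi ifw) _.
apply: le_Rintegral => //; first exact: integrable_norm.
- exact: integrable0piZ.
- by move=> x Ix; rewrite normrM ler_wpM2r// fC.
Qed.

(** The index runs along an arbitrary filter, so dominated convergence, which is
    about sequences, does not apply; uniform convergence does. *)
Lemma cvg_integral0pi_unif (U : set_system nat) (FU : Filter U) (f : nat -> R -> R) g
  w :
    (forall m, bounded_mfun (f m)) -> bounded_mfun g -> integrable0pi w ->
    (forall e : R, 0 < e -> \forall m \near U, forall x, itv0pi x ->
      `|f m x - g x| <= e) ->
  integral0pi (fun x => f m x * w x) @[m --> U] --> integral0pi (fun x => g x * w x).
Proof.
move=> bf bg iw fg; apply/cvgrPdist_le => e e0.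
pose W := integral0pi (fun x => `|w x|).
have W0 : 0 <= W by exact: Rintegral_ge0.
have W1 : 0 < W + 1 by rewrite ltr_wpDl.
have := fg (e / (W + 1)) (divr_gt0 e0 W1); apply: filterS => m mP.
have bd : bounded_mfun (fun x => f m x - g x) by exact: bounded_mfunB.
have := norm_integral0pi_le _ _ _ bd iw mP.
have -> : integral0pi (fun x => (f m x - g x) * w x)
  = integral0pi (fun x => f m x * w x) - integral0pi (fun x => g x * w x).
  have -> : (fun x => (f m x - g x) * w x)
    = (fun x => f m x * w x + -1 * (g x * w x)).
    by apply/funext => x; ring.
  rewrite integral0piD; [|exact: integrable0piM|by apply: integrable0piZ;
    exact: integrable0piM].
  by rewrite integral0piZ; [rewrite mulN1r|exact: integrable0piM].
rewrite distrC => /le_trans; apply; rewrite -/W mulrAC ler_pdivrMr//.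
by apply: ler_wpM2l; rewrite ?lerDl ?(ltW e0).
Qed.

End integral0pi.

(** * Derivatives and a continuously differentiable cutoff *)

(** Handles all points at once for a function defined by cases, without a separate
    discussion of the junction. *)
Lemma is_derive_of_quadratic_error (R : realType) (f : R -> R) (x l C : R) :
  (forall h, `|f (x + h) - f x - l * h| <= C * h ^+ 2) -> is_derive x 1 f l.
Proof.
move=> H.
have C0 : 0 <= C by have := le_trans (normr_ge0 _) (H 1); rewrite expr1n mulr1.
have cvgl : h^-1 *: ((f \o shift x) (h *: (1 : R)) - f x) @[h --> 0^'] --> l.
  apply/cvgrPdist_le => e e0; near=> h.
  have h0 : h != 0 by near: h; exact: nbhs_dnbhs_neq.
  have hn : 0 < `|h| by rewrite normr_gt0.
  have he : `|h| <= e / (C + 1).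
    near: h; apply: dnbhs0_le; rewrite divr_gt0// ltr_wpDl//.
  rewrite /= -[_ *: (1 : R)]/(_ * _) mulr1 -[_ *: _]/(_ * _).
  rewrite -(ler_pM2l hn) -normrM mulrBr mulrA mulfV// mul1r.
  rewrite distrC (mulrC h l); apply: le_trans (_ : `|h| * (C * `|h|) <= _).
    rewrite [h + x]addrC; apply: le_trans (H h) _.
    by rewrite [leRHS]mulrCA -[X in _ <= _ * X]expr2 real_normK ?num_real.
  rewrite ler_wpM2l// (le_trans (ler_wpM2l C0 he))//.
  rewrite mulrA ler_pdivrMr ?ltr_wpDl// mulrC ler_wpM2l ?(ltW e0)// lerDl//.
have ex : derivable f x 1 by apply/cvg_ex; exists l.
by apply: DeriveDef => //; apply: cvg_lim.
Unshelve. all: by end_near. Qed.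

(** The square of the positive part: a continuously differentiable function
    vanishing on the negative axis. *)
Definition ppart2 {R : realType} (t : R) : R := Num.max t 0 ^+ 2.

Lemma is_derive_ppart2 (R : realType) (t : R) :
  is_derive t 1 (@ppart2 R) (2 * Num.max t 0).
Proof.
apply: (@is_derive_of_quadratic_error _ _ _ _ 1) => h; rewrite /ppart2 mul1r.
rewrite ler_norml; apply/andP; split;
  rewrite /Num.max; case: ltP => ?; case: ltP => ?; nra.
Qed.

Lemma ppart2_ge0 (R : realType) (t : R) : 0 <= ppart2 t.
Proof. exact: sqr_ge0. Qed.

Lemma ppart2_continuous (R : realType) : continuous (@ppart2 R).
Proof.
move=> t; apply/differentiable_continuous/derivable1_diffP.
exact: (@ex_derive _ _ _ _ _ _ _ (is_derive_ppart2 R t)).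
Qed.

Lemma max0_continuous (R : realType) : continuous (fun t : R => Num.max t 0).
Proof. by move=> t; apply: continuous_max => //; exact: cvg_cst. Qed.

(** With s the positive part of t - d, this is s^2 / (s^2 + d^2): a continuously
    differentiable function that vanishes for t <= d and tends to 1 for every t > 0
    as d tends to 0. *)
Definition soft_step {R : realType} (d t : R) : R :=
  ppart2 (t - d) / (ppart2 (t - d) + d ^+ 2).

Definition soft_step' {R : realType} (d t : R) : R :=
  2 * Num.max (t - d) 0 * d ^+ 2 / (ppart2 (t - d) + d ^+ 2) ^+ 2.

Lemma soft_step_den_gt0 {R : realType} (d t : R) : 0 < d ->
  0 < ppart2 (t - d) + d ^+ 2.
Proof. by move=> d0; rewrite ltr_wpDl ?exprn_gt0// ppart2_ge0. Qed.

Section derivative_rules.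
Variable R : realType.
Implicit Types (f g : R -> R) (x a b : R).

(** The usual rules, for functions given as abstractions rather than as pointwise
    operations. *)
Lemma is_derive_cst_fun x (c : R) : is_derive x 1 (fun=> c) 0.
Proof. exact: is_derive_cst. Qed.

Lemma is_derive_id_fun x : is_derive x 1 (fun y : R => y) 1.
Proof. exact: is_derive_id. Qed.

Lemma is_deriveD_fun f g x a b : is_derive x 1 f a -> is_derive x 1 g b ->
  is_derive x 1 (fun y => f y + g y) (a + b).
Proof. exact: is_deriveD. Qed.

Lemma is_deriveM_fun f g x a b : is_derive x 1 f a -> is_derive x 1 g b ->
  is_derive x 1 (fun y => f y * g y) (a * g x + f x * b).
Proof.
move=> fa gb; rewrite addrC [a * _]mulrC; exact: is_deriveM.
Qed.

Lemma is_derive_comp_fun f g x a b : is_derive (g x) 1 f a -> is_derive x 1 g b ->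
  is_derive x 1 (fun y => f (g y)) (a * b).
Proof. exact: is_derive1_comp. Qed.

Lemma is_deriveZ_fun f x a (c : R) : is_derive x 1 f a ->
  is_derive x 1 (fun y => c * f y) (c * a).
Proof. by move=> fa; have := is_deriveM_fun _ _ _ _ _ (is_derive_cst_fun x c) fa;
  rewrite mul0r add0r. Qed.

Lemma is_derive_sum_fun I (r : seq I) (f df : I -> R -> R) x :
    (forall i, is_derive x 1 (f i) (df i x)) ->
  is_derive x 1 (fun y => \sum_(i <- r) f i y) (\sum_(i <- r) df i x).
Proof.
move=> fd; elim: r => [|i r IH].
  by under eq_fun do rewrite big_nil; rewrite big_nil; exact: is_derive_cst_fun.
by under eq_fun do rewrite big_cons; rewrite big_cons; exact: is_deriveD_fun.
Qed.

Lemma is_derive_eq_val f x a b : a = b -> is_derive x 1 f a -> is_derive x 1 f b.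
Proof. by move=> ->. Qed.

Lemma is_derive_continuous_at f x a : is_derive x 1 f a -> {for x, continuous f}.
Proof. by move=> [df _]; apply/differentiable_continuous/derivable1_diffP. Qed.

Lemma is_derive_continuous f df : (forall x, is_derive x 1 f (df x)) -> continuous f.
Proof. by move=> fd x; exact: is_derive_continuous_at (fd x). Qed.

End derivative_rules.

Lemma is_derive_soft_step (R : realType) (d t : R) : 0 < d ->
  is_derive t 1 (soft_step d) (soft_step' d t).
Proof.
move=> d0.
have h0 : is_derive t 1 (fun s => s - d) 1.
  by apply: is_derive_eq_val
    (is_deriveD_fun _ _ _ _ _ _ (is_derive_id_fun R t)
    (is_derive_cst_fun R t (- d))); rewrite addr0.
have h1 := is_derive_comp_fun R _ (fun s => s - d) t _ _ (is_derive_ppart2 R (t - d))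
  h0.
have h2 := is_deriveD_fun _ _ _ _ _ _ h1 (is_derive_cst_fun R t (d ^+ 2)).
have den := soft_step_den_gt0 d t d0.
have h3 := @is_deriveV R (fun s => ppart2 (s - d) + d ^+ 2) t _ 1 (lt0r_neq0 den) h2.
apply: is_derive_eq_val (is_deriveM_fun _ _ _ _ _ _ h1 h3).
rewrite /soft_step' -[_ *: _]/(_ * _); field; exact: lt0r_neq0.
Qed.

Lemma continuous_comp_fun (R : realType) (f g : R -> R) : continuous f ->
  continuous g ->
  continuous (fun x => f (g x)).
Proof. by move=> cf cg x; apply: (@continuous_comp _ _ _ g f);
  [exact: cg|exact: cf]. Qed.

Lemma soft_step'_continuous (R : realType) (d : R) : 0 < d ->
  continuous (soft_step' d).
Proof.
move=> d0 t; rewrite /soft_step'.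
have cs : continuous (fun s : R => s - d).
  by move=> s; apply: cvgB; [exact: cvg_id|exact: cvg_cst].
have cden : continuous (fun s : R => ppart2 (s - d) + d ^+ 2).
  move=> s; apply: cvgD; last exact: cvg_cst.
  exact: (continuous_comp_fun _ _ _ (@ppart2_continuous R) cs).
apply: cvgM.
  apply: cvgM; last exact: cvg_cst.
  apply: cvgM; first exact: cvg_cst.
  exact: (continuous_comp_fun _ _ _ (@max0_continuous R) cs).
apply: cvgV; first by rewrite expf_neq0// lt0r_neq0// soft_step_den_gt0.
rewrite expr2; under eq_fun do rewrite expr2; apply: cvgM; exact: cden.
Qed.

Lemma soft_step_le1 (R : realType) (d t : R) : 0 < d -> 0 <= soft_step d t <= 1.
Proof.
move=> d0; have den := soft_step_den_gt0 d t d0; rewrite /soft_step.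
rewrite divr_ge0 ?ppart2_ge0 ?(ltW den)//= ler_pdivrMr// mul1r lerDl sqr_ge0//.
Qed.

Lemma soft_step_eq0 (R : realType) (d t : R) : t <= d -> soft_step d t = 0.
Proof.
move=> td; rewrite /soft_step /ppart2 max_r ?subr_le0//.
by rewrite expr0n /= mul0r.
Qed.

(** The bound does not depend on d: this is what makes the product of a function
    vanishing at the end points and of the derivative of the cutoff bounded. *)
Lemma soft_step'_bound (R : realType) (d t : R) : 0 < d -> 0 <= t ->
  `|t * soft_step' d t| <= 3.
Proof.
move=> d0 t0; have den := soft_step_den_gt0 d t d0; rewrite /soft_step'.
have m0 : 0 <= Num.max (t - d) 0 by rewrite le_max lexx orbT.
rewrite ger0_norm; last first.
  apply: mulr_ge0 => //; apply: divr_ge0; last exact: sqr_ge0.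
  by apply: mulr_ge0; [exact: mulr_ge0|exact: sqr_ge0].
rewrite mulrA ler_pdivrMr ?exprn_gt0//.
move: m0 den; rewrite /ppart2; have [td|td] := leP (t - d) 0.
  move=> _ _; rewrite mulr0 mul0r mulr0 mulr_ge0// sqr_ge0//.
move=> m0 den; have -> : t = (t - d) + d by ring.
rewrite addrK; set s := t - d in td *.
have h1 : (s + d) * (2 * s) <= 3 * (s ^+ 2 + d ^+ 2).
  rewrite -subr_ge0; have ->
    : 3 * (s ^+ 2 + d ^+ 2) - (s + d) * (2 * s) = (s - d) ^+ 2 + 2 * d ^+ 2 by ring.
  by rewrite addr_ge0 ?sqr_ge0// mulr_ge0// sqr_ge0.
have h2 : d ^+ 2 <= s ^+ 2 + d ^+ 2 by rewrite lerDr sqr_ge0.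
rewrite mulrA [X in _ <= 3 * X]expr2 [X in _ <= X]mulrA; apply: ler_pM => //;
  last exact: sqr_ge0.
by apply: mulr_ge0; [apply: addr_ge0; exact: ltW|apply: mulr_ge0 => //; exact: ltW].
Qed.

Lemma cvg_soft_step (R : realType) (d : nat -> R) (t : R) : 0 < t ->
    d m @[m --> \oo] --> (0 : R) ->
  soft_step (d m) t @[m --> \oo] --> (1 : R).
Proof.
move=> t0 d0.
have td : t - d m @[m --> \oo] --> t by rewrite -[X in _ --> X](subr0 t);
  apply: cvgB => //; exact: cvg_cst.
have pt : ppart2 t = t ^+ 2 by rewrite /ppart2 max_l// ltW.
have cp : ppart2 (t - d m) @[m --> \oo] --> t ^+ 2.
  by rewrite -pt; exact: (@continuous_cvg _ _ _ _ _ _ (@ppart2 R) _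
    (@ppart2_continuous R t) td).
have dd : d m ^+ 2 @[m --> \oo] --> (0 : R).
  by rewrite -(mulr0 0); under eq_fun do rewrite expr2; apply: cvgM.
have t2 : t ^+ 2 != 0 by rewrite expf_neq0// lt0r_neq0.
rewrite -(@divff _ (t ^+ 2))//; apply: cvgM => //; apply: cvgV => //.
by rewrite -[X in _ --> X]addr0; apply: cvgD.
Qed.

Lemma cvg_soft_step' (R : realType) (d : nat -> R) (t : R) : 0 < t ->
    d m @[m --> \oo] --> (0 : R) ->
  soft_step' (d m) t @[m --> \oo] --> (0 : R).
Proof.
move=> t0 d0.
have td : t - d m @[m --> \oo] --> t by rewrite -[X in _ --> X](subr0 t);
  apply: cvgB => //; exact: cvg_cst.
have pt : ppart2 t = t ^+ 2 by rewrite /ppart2 max_l// ltW.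
have cp : ppart2 (t - d m) @[m --> \oo] --> t ^+ 2.
  by rewrite -pt; exact: (@continuous_cvg _ _ _ _ _ _ (@ppart2 R) _
    (@ppart2_continuous R t) td).
have cm : Num.max (t - d m) 0 @[m --> \oo] --> Num.max t 0.
  exact: (@continuous_cvg _ _ _ _ _ _ (fun t : R => Num.max t 0) _
    (@max0_continuous R t) td).
have dd : d m ^+ 2 @[m --> \oo] --> (0 : R).
  by rewrite -(mulr0 0); under eq_fun do rewrite expr2; apply: cvgM.
have t2 : (t ^+ 2 + 0) ^+ 2 != 0 by rewrite addr0 -exprM expf_neq0// lt0r_neq0.
have : soft_step' (d m) t @[m --> \oo] --> 2 * Num.max t 0 * 0 / (t ^+ 2 + 0) ^+ 2.
  apply: cvgM; first by apply: cvgM => //; apply: cvgM => //; exact: cvg_cst.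
  apply: cvgV => //.
  by rewrite expr2; under eq_fun do rewrite expr2; apply: cvgM; apply: cvgD.
by rewrite mulr0 mul0r.
Qed.

(** * Integration by parts *)

Section parts.
Variable R : realType.
Implicit Types (F G f g w v dv : R -> R) (a b x : R).

Lemma is_derive_derivable_oo F f a b : (forall x : R, is_derive x 1 F (f x)) ->
  derivable_oo_LRcontinuous F a b.
Proof.
move=> Ff; have cF := is_derive_continuous _ _ _ Ff; split.
- by move=> x _; exact: (@ex_derive _ _ _ _ _ _ _ (Ff x)).
- by apply: cvg_at_right_filter; exact: cF.
- by apply: cvg_at_left_filter; exact: cF.
Qed.

Lemma is_derive_derive1 F x (c : R) : is_derive x 1 F c -> F^`()%classic x = c.
Proof. by move=> Ff; rewrite derive1E; exact: derive_val. Qed.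

Lemma integral0pi_parts F G f g :
    (forall x : R, is_derive x 1 F (f x)) -> (forall x : R, is_derive x 1 G (g x)) ->
    continuous f -> continuous g ->
  integral0pi (fun x => F x * g x) = F pi * G pi - F 0 * G 0
    - integral0pi (fun x => f x * G x).
Proof.
move=> Ff Gg cf cg.
have cF := is_derive_continuous _ _ _ Ff; have cG := is_derive_continuous _ _ _ Gg.
have toCC (h : R -> R) : continuous h ->
    integral0pi h = \int[@lebesgue_measure R]_(x in `[0, pi]) h x.
  move=> ch.
  have ih : (@lebesgue_measure R).-integrable `[0, pi]%classic (EFin \o h).
    apply: continuous_compact_integrable; first exact: segment_compact.
    exact: continuous_subspaceT.
  rewrite /integral0pi /itv0pi Rintegral_itv_obnd_cbnd ?Rintegral_itv_bndo_bndc//;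
    apply: integrableS ih => //=; apply: subset_itv; by rewrite ?bnd_simp.
rewrite !toCC; last 2 first.
- by move=> x; apply: cvgM; [exact: cf|exact: cG].
- by move=> x; apply: cvgM; [exact: cF|exact: cg].
apply: Rintegration_by_parts.
- exact: pi_gt0.
- exact: continuous_subspaceT.
- exact: is_derive_derivable_oo Ff.
- by move=> x _; exact: is_derive_derive1.
- exact: continuous_subspaceT.
- exact: is_derive_derivable_oo Gg.
- by move=> x _; exact: is_derive_derive1.
Qed.

Lemma cvg_integral0pi_dominated (f : nat -> R -> R) g (C : R) w :
    (forall m, bounded_mfun (f m)) -> bounded_mfun g -> integrable0pi w ->
    (forall m x, itv0pi x -> `|f m x| <= C) ->
    (forall x, itv0pi x -> f m x @[m --> \oo] --> g x) ->
  integral0pi (fun x => f m x * w x) @[m --> \oo]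
    --> integral0pi (fun x => g x * w x).
Proof.
move=> bf bg iw fC fg.
have ifw m := integrable0piM _ _ _ (bf m) iw; have igw := integrable0piM _ _ _ bg iw.
have C0 : 0 <= C.
  have := fC 0%N (pi / 2); rewrite /itv0pi /= in_itv /= => h.
  by apply: le_trans (h _) => //;
    rewrite divr_gt0 ?pi_gt0//= ltr_pdivrMr// ltr_pMr ?pi_gt0// ltr1n.
have iCw : integrable0pi (fun x => C * `|w x|).
  have iaw : integrable0pi (fun x => `|w x|) by exact: integrable_norm.
  exact: integrable0piZ.
have := @dominated_cvg _ _ R (@lebesgue_measure R) itv0pi (measurable_itv0pi R)
  (fun m x => (f m x * w x)%:E) (fun x => (g x * w x)%:E) (fun x => (C * `|w x|)%:E).
move=> /(_ (fun m => measurable_int _ (ifw m))).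
move=> h; apply: fine_cvg; rewrite fineK; last by apply: integrable_fin_num;
  [exact: measurable_itv0pi|exact: igw].
apply: h => //.
- move=> x Ix; apply: cvg_EFin; first by apply: nearW.
  by apply: cvgM; [exact: fg|exact: cvg_cst].
- by move=> m x Ix; rewrite lee_fin normrM ler_wpM2r// fC.
Qed.

End parts.

Section h1_parts.
Variable R : realType.
Implicit Types (v dv w dw phi : R -> R) (x t d : R).

Lemma test_function_is_derive phi x : test_function phi ->
  is_derive x 1 phi (derive1 phi x).
Proof. by move=> [dphi _ _]; rewrite derive1E; apply/derivableP. Qed.

Lemma test_function_boundary phi : test_function phi -> phi 0 = 0 /\ phi pi = 0.
Proof.
move=> [_ _ [a [b [a0 bpi phi0]]]]; split; apply: phi0 => /andP[].
  by rewrite leNgt a0.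
by rewrite (leNgt pi) bpi.
Qed.

(** The classical derivative is the weak one; the boundary terms vanish with the
    test function. *)
Lemma smooth_weak_derivative w dw phi :
    (forall x, is_derive x 1 w (dw x)) -> continuous dw -> test_function phi ->
  integral0pi (fun x => w x * derive1 phi x) = - integral0pi (fun x => dw x * phi x).
Proof.
move=> wd cdw tphi; have [phi0 phipi] := test_function_boundary _ tphi.
have [_ cphi _] := tphi.
rewrite (integral0pi_parts _ _ _ _ _ wd (test_function_is_derive _ ^~ tphi) cdw cphi).
by rewrite phi0 phipi !mulr0 subrr sub0r.
Qed.

(** By the mean value theorem |w| is at most C x and C (pi - x), hence at most a
    multiple of x (pi - x), the argument of the cutoff. *)
Lemma vanishing_bound w dw : (forall x, is_derive x 1 w (dw x)) -> continuous dw ->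
    w 0 = 0 -> w pi = 0 ->
  exists C, 0 <= C /\ forall x, itv0pi x ->
    [/\ `|dw x| <= C, `|w x| <= C * pi & `|w x| * pi <= 2 * C * (x * (pi - x))].
Proof.
move=> wd cdw w0 wpi; have cw := is_derive_continuous _ _ _ wd.
have [_ [C dwC]] := continuous_bounded_mfun _ _ cdw.
have lip (a b : R) : 0 <= a -> a < b -> b <= pi -> `|w b - w a| <= C * (b - a).
  move=> a0 ab bpi.
  have [|c /itvP cab ->] := @MVT R w dw a b ab (fun x _ => wd x).
    exact: continuous_subspaceT.
  rewrite normrM [X in _ * X]ger0_norm ?subr_ge0 ?(ltW ab)// ler_wpM2r ?subr_ge0
    ?(ltW ab)//.
  apply: dwC; rewrite /itv0pi /= in_itv /=; apply/andP; split.
    by rewrite (le_lt_trans a0)// cab.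
  by rewrite (lt_le_trans _ bpi)// cab.
exists C.
have mid : itv0pi (pi / 2 : R).
  by rewrite /itv0pi /= in_itv /= divr_gt0 ?pi_gt0//= ltr_pdivrMr// ltr_pMr ?pi_gt0//
    ltr1n.
have C0 : 0 <= C by apply: le_trans (dwC _ mid).
split=> // x Ix; move: (Ix); rewrite /itv0pi /= in_itv /= => /andP[x0 xpi].
have h1 : `|w x| <= C * x.
  by have := lip 0 x (lexx _) x0 (ltW xpi); rewrite w0 !subr0.
have h2 : `|w x| <= C * (pi - x).
  by have := lip x pi (ltW x0) xpi (lexx _); rewrite wpi sub0r normrN.
split; first exact: dwC.
  by apply: le_trans h1 _; rewrite ler_wpM2l// ltW.
have h3 : `|w x| * (pi - x) <= C * x * (pi - x) by rewrite ler_wpM2r// subr_ge0 ltW.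
have h4 : `|w x| * x <= C * (pi - x) * x by rewrite ler_wpM2r// ltW.
have -> : `|w x| * pi = `|w x| * (pi - x) + `|w x| * x by ring.
by apply: le_trans (lerD h3 h4) _; rewrite le_eqVlt; apply/orP; left; apply/eqP; ring.
Qed.

(** The argument x (pi - x) is positive exactly on (0, pi), so for d > 0 the
    function vanishes near the end points and outside the interval. *)
Definition bump (d x : R) : R := soft_step d (x * (pi - x)).
Definition bump' (d x : R) : R := soft_step' d (x * (pi - x)) * (pi - x - x).

Lemma is_derive_bump d x : 0 < d -> is_derive x 1 (bump d) (bump' d x).
Proof.
move=> d0.
have hb : is_derive x 1 (fun y => y * (pi - y)) (pi - x - x).
  have := is_deriveM_fun _ _ _ _ _ _ (is_derive_id_fun R x)
    (is_deriveD_fun _ _ _ _ _ _ (is_derive_cst_fun R x pi)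
    (is_deriveZ_fun _ _ _ _ (-1) (is_derive_id_fun R x))).
  under eq_fun do rewrite mulN1r; apply: is_derive_eq_val; ring.
have := is_derive_comp_fun R _ (fun y => y * (pi - y)) x _ _
  (is_derive_soft_step _ d _ d0) hb.
by [].
Qed.

Lemma bump'_continuous d : 0 < d -> continuous (bump' d).
Proof.
move=> d0 x; have cb : continuous (fun y : R => pi - y).
  by move=> y; apply: cvgB; [exact: cvg_cst|exact: cvg_id].
apply: cvgM.
  apply: (continuous_comp_fun _ _ (fun y : R => y * (pi - y))
    (soft_step'_continuous _ _ d0)).
  by move=> y; apply: cvgM; [exact: cvg_id|exact: cb].
by apply: cvgB; [exact: cb|exact: cvg_id].
Qed.

Lemma is_derive_cutoff w dw d x : (forall x, is_derive x 1 w (dw x)) -> 0 < d ->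
  is_derive x 1 (fun y => w y * bump d y) (dw x * bump d x + w x * bump' d x).
Proof. by move=> wd d0; exact: is_deriveM_fun (wd x) (is_derive_bump _ _ d0). Qed.

Lemma cutoff_test_function w dw d :
    (forall x, is_derive x 1 w (dw x)) -> continuous dw -> 0 < d ->
  test_function (fun x => w x * bump d x).
Proof.
move=> wd cdw d0; have cutd x := is_derive_cutoff _ _ _ x wd d0.
split.
- by move=> x; exact: (@ex_derive _ _ _ _ _ _ _ (cutd x)).
- have -> : derive1 (fun x => w x * bump d x)
  = (fun x => dw x * bump d x + w x * bump' d x).
    by apply/funext => x; exact: is_derive_derive1 (cutd x).
  move=> x; apply: cvgD; apply: cvgM.
  + exact: cdw.
  + exact: (is_derive_continuous_at _ _ _ _ (is_derive_bump _ x d0)).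
  + exact: (is_derive_continuous_at _ _ _ _ (wd x)).
  + exact: bump'_continuous.
(* For 0 <= x < d / pi, x (pi - x) <= x pi < d; the other end is symmetric. *)
- have pi0 := pi_gt0 R; exists (d / pi), (pi - d / pi); split.
  + by rewrite divr_gt0.
  + by rewrite gtrBl divr_gt0.
  + move=> x /negP; rewrite negb_and -!ltNge => H.
    rewrite /bump soft_step_eq0 ?mulr0//.
    have e : d = d / pi * pi by rewrite mulfVK// gt_eqF.
    have e0 : 0 < d / pi by rewrite divr_gt0.
    set e' := d / pi in e e0 H.
    rewrite e; case/orP: H => H; have [x0|x0] := leP x 0; have [xp|xp] := leP pi x;
      nra.
Qed.

(** Test functions have compact support in (0, pi), so w, which only vanishes at the
    end points, is multiplied by the cutoffs with parameter 1 / (m + 1). The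
    derivatives of the products converge pointwise to w' and stay bounded, because
    |w| is at most a multiple of x (pi - x); dominated convergence concludes. *)
Lemma H1_parts v dv w dw : H1 v dv ->
    (forall x, is_derive x 1 w (dw x)) -> continuous dw -> w 0 = 0 -> w pi = 0 ->
  integral0pi (fun x => dv x * w x) = - integral0pi (fun x => v x * dw x).
Proof.
move=> [v2 dv2 vdv] wd cdw w0 wpi.
have iv := L2_integrable0pi _ _ v2; have idv := L2_integrable0pi _ _ dv2.
have cw := is_derive_continuous _ _ _ wd.
have [C [C0 CP]] := vanishing_bound _ _ wd cdw w0 wpi.
pose d m : R := m.+1%:R^-1.
have d0 m : 0 < d m by rewrite invr_gt0.
have dcvg : d m @[m --> \oo] --> (0 : R) by exact: cvg_harmonic.
pose f m x := w x * bump (d m) x.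
pose g m x := dw x * bump (d m) x + w x * bump' (d m) x.
have fg m : integral0pi (fun x => g m x * v x) =
  - integral0pi (fun x => f m x * dv x).
  have tf := cutoff_test_function _ _ _ wd cdw (d0 m).
  have := vdv _ tf; rewrite -!/(integral0pi _) => h.
  have -> : (fun x => g m x * v x)
    = (fun x => v x * derive1 (fun x => w x * bump (d m) x) x).
    apply/funext => x; rewrite mulrC; congr (_ * _); apply/esym.
    exact: is_derive_derive1 (is_derive_cutoff _ _ _ x wd (d0 m)).
  by rewrite h; congr (- integral0pi _); apply/funext => x; rewrite mulrC.
have cbump m : continuous (bump (d m)).
  exact: is_derive_continuous (fun x => is_derive_bump _ x (d0 m)).
have bf m : bounded_mfun (f m).
  by apply: continuous_bounded_mfun => x; apply: cvgM; [exact: cw|exact: cbump].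
have bg m : bounded_mfun (g m).
  apply: continuous_bounded_mfun => x; apply: cvgD; apply: cvgM.
  - exact: cdw.
  - exact: cbump.
  - exact: cw.
  - exact: bump'_continuous.
have bump1 m x : `|bump (d m) x| <= 1.
  have /andP[h0 h1] := soft_step_le1 _ (d m) (x * (pi - x)) (d0 m).
  by rewrite ger0_norm.
have Ipos x : itv0pi x -> 0 < x * (pi - x).
  by rewrite /itv0pi /= in_itv /= => /andP[x0 xp]; rewrite mulr_gt0// subr_gt0.
have fC m x : itv0pi x -> `|f m x| <= C * pi.
  by move=> /CP[_ h _]; rewrite normrM (le_trans _ h)// ler_piMr.
have gC m x : itv0pi x -> `|g m x| <= 7 * C.
  move=> Ix; have [h1 _ h2] := CP _ Ix; have bp := Ipos _ Ix.
  have h3 : `|dw x * bump (d m) x| <= C by rewrite normrM (le_trans _ h1)// ler_piMr.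
  have h4 : `|w x * bump' (d m) x| <= 6 * C.
    rewrite /bump' normrM [`|_ * (pi - x - x)|]normrM.
    have hpi : `|pi - x - x| <= pi.
      move: Ix; rewrite /itv0pi /= in_itv /= => /andP[x0 xp].
      by rewrite ler_norml; apply/andP; split; lra.
    have hs := soft_step'_bound _ (d m) (x * (pi - x)) (d0 m) (ltW bp).
    rewrite normrM ger0_norm ?(ltW bp)// in hs.
    set s := `|soft_step' _ _| in hs *.
    have s0 : 0 <= s by exact: normr_ge0.
    apply: (@le_trans _ _ (`|w x| * (s * pi))); first by do 2 apply: ler_wpM2l => //.
    apply: (@le_trans _ _ (2 * C * (x * (pi - x)) * s)).
      have -> : `|w x| * (s * pi) = `|w x| * pi * s by ring.
      by rewrite ler_wpM2r.
    have -> : 2 * C * (x * (pi - x)) * s = (2 * C) * ((x * (pi - x)) * s) by ring.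
    have -> : 6 * C = (2 * C) * 3 by ring.
    by rewrite ler_wpM2l// mulr_ge0.
  apply: le_trans (ler_normD _ _) _; lra.
have cvf x : itv0pi x -> f m x @[m --> \oo] --> w x.
  move=> Ix; rewrite -[X in _ --> X]mulr1; apply: cvgM; first exact: cvg_cst.
  exact: cvg_soft_step (Ipos _ Ix) dcvg.
have cvg' x : itv0pi x -> g m x @[m --> \oo] --> dw x.
  move=> Ix; have : g m x @[m --> \oo] --> dw x * 1 + w x * (0 * (pi - x - x)).
    apply: cvgD; apply: cvgM; first exact: cvg_cst.
    - exact: cvg_soft_step (Ipos _ Ix) dcvg.
    - exact: cvg_cst.
    - by apply: cvgM; [exact: cvg_soft_step' (Ipos _ Ix) dcvg|exact: cvg_cst].
  by rewrite mul0r mulr0 addr0 mulr1.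
have L1 := cvg_integral0pi_dominated _ _ _ _ _ bf (continuous_bounded_mfun _ _ cw)
  idv fC cvf.
have L2 := cvg_integral0pi_dominated _ _ _ _ _ bg (continuous_bounded_mfun _ _ cdw)
  iv gC cvg'.
have L3 : - integral0pi (fun x => f m x * dv x) @[m --> \oo]
  --> integral0pi (fun x => dw x * v x).
  by apply: cvg_trans L2; apply: near_eq_cvg; apply: nearW => m /=; rewrite fg.
have : - integral0pi (fun x => w x * dv x) = integral0pi (fun x => dw x * v x).
  by rewrite -(cvg_lim (@norm_hausdorff _ _) (cvgN L1))
    -(cvg_lim (@norm_hausdorff _ _) L3).
have -> : (fun x => dv x * w x) = (fun x => w x * dv x) by apply/funext => x;
  rewrite mulrC.
have -> : (fun x => v x * dw x) = (fun x => dw x * v x) by apply/funext => x;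
  rewrite mulrC.
by move=> <-; rewrite opprK.
Qed.

End h1_parts.

(** * Trigonometric integrals and cosine polynomials *)

Section trigonometric_integrals.
Variable R : realType.
Implicit Types (x p : R) (c d : nat -> R).

Lemma sin_natpi n : sin (n%:R * pi : R) = 0.
Proof.
elim: n => [|n IH]; first by rewrite mul0r sin0.
by rewrite -natr1 mulrDl mul1r sinDpi IH oppr0.
Qed.

Lemma is_derive_mulcl p x : is_derive x 1 (fun y : R => p * y) p.
Proof. by apply: is_derive_eq_val (is_deriveZ_fun _ _ _ _ p (is_derive_id_fun R x));
  rewrite mulr1. Qed.

Lemma is_derive_cosM p x : is_derive x 1 (fun y : R => cos (p * y))
  (- p * sin (p * x)).
Proof.
apply: is_derive_eq_val (is_derive_comp_fun R _ (fun y => p * y) x _ _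
  (is_derive_cos (p * x)) (is_derive_mulcl p x)).
by ring.
Qed.

Lemma is_derive_sinM p x : is_derive x 1 (fun y : R => sin (p * y)) (p * cos (p * x)).
Proof.
apply: is_derive_eq_val (is_derive_comp_fun R _ (fun y => p * y) x _ _
  (is_derive_sin (p * x)) (is_derive_mulcl p x)).
by ring.
Qed.

Lemma continuous_cosM p : continuous (fun x : R => cos (p * x)).
Proof. exact: is_derive_continuous (is_derive_cosM p). Qed.

Lemma integral0pi_cst (c : R) : integral0pi (fun=> c) = c * pi.
Proof.
have e : lebesgue_measure (itv0pi : set R) = pi%:E.
  by rewrite /itv0pi lebesgue_measure_itv /= lte_fin pi_gt0 /= oppr0 adde0.
rewrite /integral0pi Rintegral_cst; last exact: measurable_itv0pi.
by rewrite -[X in _ = _ * X]/(fine pi%:E) -e.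
Qed.

Lemma integral0pi_cosM p : p != 0 -> sin (p * pi) = 0 ->
  integral0pi (fun x => cos (p * x)) = 0.
Proof.
move=> p0 sp.
have := @integral0pi_parts R (fun=> 1) (fun x => sin (p * x)) (fun=> 0)
  (fun x => p * cos (p * x))
  (fun x => is_derive_cst_fun R x 1) (is_derive_sinM p).
have -> : integral0pi (fun x => 1 * (p * cos (p * x))) = p
  * integral0pi (fun x => cos (p * x)).
  under eq_fun do rewrite mul1r; apply: integral0piZ.
  by apply: bounded_mfun_integrable; apply: continuous_bounded_mfun;
    exact: continuous_cosM.
have -> : integral0pi (fun x => 0 * sin (p * x)) = 0 :> R.
  by under eq_fun do rewrite mul0r; rewrite integral0pi_cst mul0r.
rewrite sp !mulr0 sin0 mulr0 !subrr => h.
have /eqP : p * integral0pi (fun x => cos (p * x)) = 0.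
  apply: h; first by move=> x; exact: cvg_cst.
  by move=> x; apply: cvgM; [exact: cvg_cst|exact: continuous_cosM].
by rewrite mulf_eq0 (negPf p0) => /eqP.
Qed.

Lemma integral0pi_cos_cos (k l : nat) :
  integral0pi (fun x : R => cos (k%:R * x) * cos (l%:R * x)) = (k == l)%:R
    * (pi / 2 / cos_weight R k).
Proof.
have ic p : integrable0pi (fun x : R => cos (p * x)).
  by apply: bounded_mfun_integrable; apply: continuous_bounded_mfun;
    exact: continuous_cosM.
under eq_fun do rewrite cos_mul_cos mulrC -mulrDl -mulrBl.
rewrite integral0piZ; last by apply: integrable0piD; exact: ic.
rewrite integral0piD ?ic//.
have [<-|kl] := eqVneq k l.
  have -> : integral0pi (fun x : R => cos ((k%:R - k%:R) * x)) = pi.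
    by under eq_fun do rewrite subrr mul0r cos0; rewrite integral0pi_cst mul1r.
  rewrite /cos_weight; have [->|k0] := eqVneq k 0%N.
    have -> : integral0pi (fun x : R => cos ((0%:R + 0%:R) * x)) = pi.
      by under eq_fun do rewrite addr0 mul0r cos0; rewrite integral0pi_cst mul1r.
    by rewrite (_ : true%:R = 1)//; field.
  rewrite integral0pi_cosM ?add0r; first by rewrite (_ : true%:R = 1)//; field.
    by rewrite -natrD pnatr_eq0 addn_eq0 (negPf k0).
  by rewrite -natrD sin_natpi.
rewrite mul0r !integral0pi_cosM ?addr0 ?mulr0//.
- by rewrite subr_eq0 eqr_nat.
- by rewrite mulrBl sinB !sin_natpi mul0r mulr0 subrr.
- rewrite -natrD pnatr_eq0 addn_eq0; apply: contra kl => /andP[/eqP-> /eqP->//].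
- by rewrite -natrD sin_natpi.
Qed.

Definition cos_poly c N x : R := \sum_(0 <= k < N) c k * cos (k%:R * x).
Definition sin_poly c N x : R := \sum_(0 <= k < N) c k * sin (k%:R * x).

Lemma is_derive_cos_poly c N x :
  is_derive x 1 (cos_poly c N) (sin_poly (fun k => - (k%:R * c k)) N x).
Proof.
apply: is_derive_eq_val (is_derive_sum_fun _ _ _ _
  (fun k y => c k * (- k%:R * sin (k%:R * y))) x _).
  by apply: eq_bigr => k _; ring.
by move=> k; apply: is_deriveZ_fun; exact: is_derive_cosM.
Qed.

Lemma is_derive_sin_poly c N x :
  is_derive x 1 (sin_poly c N) (cos_poly (fun k => k%:R * c k) N x).
Proof.
apply: is_derive_eq_val (is_derive_sum_fun _ _ _ _
  (fun k y => c k * (k%:R * cos (k%:R * y))) x _).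
  by apply: eq_bigr => k _; ring.
by move=> k; apply: is_deriveZ_fun; exact: is_derive_sinM.
Qed.

Lemma cos_poly_continuous c N : continuous (cos_poly c N).
Proof. exact: is_derive_continuous (is_derive_cos_poly c N). Qed.

Lemma sin_poly_continuous c N : continuous (sin_poly c N).
Proof. exact: is_derive_continuous (is_derive_sin_poly c N). Qed.

Lemma sin_poly_boundary c N : sin_poly c N 0 = 0 /\ sin_poly c N pi = 0.
Proof.
split; rewrite /sin_poly big1// => k _; first by rewrite mulr0 sin0 mulr0.
by rewrite sin_natpi mulr0.
Qed.

(** Orthogonality of the cosines. *)
Lemma integral0pi_cos_poly c d N :
  integral0pi (fun x => cos_poly c N x * cos_poly d N x) =
  pi / 2 * \sum_(0 <= k < N) c k * d k / cos_weight R k.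
Proof.
have ic k l : integrable0pi (fun x : R => cos (k%:R * x) * cos (l%:R * x)).
  by apply: bounded_mfun_integrable; apply: bounded_mfunM;
    apply: continuous_bounded_mfun; exact: continuous_cosM.
have -> : (fun x => cos_poly c N x * cos_poly d N x) =
   (fun x => \sum_(0 <= k < N) \sum_(0 <= l < N) (c k * d l)
     * (cos (k%:R * x) * cos (l%:R * x))).
  apply/funext => x; rewrite /cos_poly mulr_suml; apply: eq_bigr => k _.
  by rewrite mulr_sumr; apply: eq_bigr => l _; ring.
rewrite integral0pi_sum; last by move=> k; apply: integrable0pi_sum => l;
  exact: integrable0piZ.
rewrite mulr_sumr; apply: eq_big_nat => k /andP[_ kN].
rewrite integral0pi_sum; last by move=> l; exact: integrable0piZ.
under eq_bigr do rewrite integral0piZ// integral0pi_cos_cos.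
rewrite big_mkord (bigD1 (Ordinal kN))//= eqxx big1 ?addr0 => [|l].
  by rewrite (_ : true%:R = 1)//; field; exact: lt0r_neq0 (cos_weight_gt0 R k).
by rewrite -val_eqE /= eq_sym => /negPf->; rewrite mul0r mulr0.
Qed.

End trigonometric_integrals.

(** * Limits of approximate eigenfunctions *)

(** The quantitative form of absolute convergence that is used below: tau L bounds
    the tail of the coefficients from L on, hence also the error of the partial sums
    of length at least L. *)
Definition cos_expansion {R : realType} (a : nat -> R) (tau : nat -> R) (q : R -> R)
  :=
  [/\ forall L n, \sum_(L <= i < n) `|a i| <= tau L,
      forall L M x, (L <= M)%N -> itv0pi x -> `|q x - cos_sum a M x| <= tau L &
      tau n @[n --> \oo] --> (0 : R)].

Section limit.
Variables (R : realType) (a tau : nat -> R) (q : R -> R).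
Hypothesis aq : cos_expansion a tau q.

Lemma cos_expansion_bounded_mfun : bounded_mfun q.
Proof.
have [_ qtau tau0] := aq.
apply: (@bounded_mfun_unif_lim _ (cos_sum a)) => [m|e e0].
  apply: continuous_bounded_mfun; rewrite /cos_sum; apply: continuous_sum_seq => k x.
  by apply: cvgM; [exact: cvg_cst|exact: continuous_cosM].
have /cvgrPdist_le/(_ _ e0) [m _ mP] := tau0.
exists m => x Ix; rewrite distrC; apply: le_trans (qtau m m x (leqnn _) Ix) _.
have := mP m (leqnn _); rewrite sub0r normrN; apply: le_trans; exact: ler_norm.
Qed.

Lemma cos_expansion_bound x : itv0pi x -> `|q x| <= tau 0%N.
Proof.
have [_ qtau _] := aq => Ix; have := qtau 0%N 0%N x (leqnn _) Ix.
by rewrite /cos_sum big_geq// subr0.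
Qed.

(** Each cosine polynomial u_m satisfies int u_m' v' = - int u_m'' v for v in H^1,
    as u_m' vanishes at the end points. There - u_m'' is l_m u_m - q u_m plus a
    residual tending uniformly to 0, so both sides converge along the ultrafilter.
    *)
Lemma weak_limit (U : set_system nat) (N : nat -> nat) (c : nat -> nat -> R)
    (l : nat -> R) (C lam : R) :
    UltraFilter U -> (forall K, \forall m \near U, (K <= N m)%N) ->
    (forall m k, `|c m k| <= C) ->
    (forall m k, (N m <= k)%N -> c m k = 0) ->
    (forall m, \sum_(0 <= k < N m) `|c m k| <= C) ->
    (forall m, \sum_(0 <= k < N m) k%:R ^+ 2 * `|c m k| <= C) ->
    (forall m j, (j < N m)%N -> j%:R ^+ 2 * c m j
      + cos_weight R j * \sum_(0 <= k < N m) mult_coef a j k * c m k = l m * c m j) ->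
    l m @[m --> U] --> lam ->
  exists u : R -> R, [/\ bounded_mfun u,
    forall e : R, 0 < e -> \forall m \near U, forall x,
      `|cos_poly _ (c m) (N m) x - u x| <= e &
    weak_neumann q lam u].
Proof.
move=> UU NU cC c0 sC s2C ev llam.
have [atau qtau tau0] := aq.
have C0 : 0 <= C by apply: le_trans (cC 0%N 0%N).
have kle m : \sum_(0 <= k < N m) k%:R * `|c m k| <= C.
  apply: le_trans (s2C m); apply: ler_sum => -[|k] _;
    first by rewrite !mul0r mulr_ge0// sqr_ge0.
  by rewrite ler_wpM2r// expr2 ler_peMl// ler1n.
have [u uU] := @ultra_unif_lim R U UU N c (fun k x => cos (k%:R * x)) C NU
  (fun k x => cos_max _) cC kle.
pose c' m k := - (k%:R * c m k).
have c'E m k : `|c' m k| = k%:R * `|c m k| by rewrite /c' normrN normrM ger0_norm.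
have c'C m k : `|c' m k| <= C.
  rewrite c'E; have [kN|kN] := ltnP k (N m); last by rewrite c0// normr0 mulr0.
  apply: le_trans (kle m); rewrite big_mkord (bigD1 (Ordinal kN))//= lerDl.
  by apply: sumr_ge0 => j _; rewrite mulr_ge0.
have kc'C m : \sum_(0 <= k < N m) k%:R * `|c' m k| <= C.
  apply: le_trans (s2C m); apply: ler_sum => k _; rewrite c'E mulrA -expr2//.
have [du duU] := @ultra_unif_lim R U UU N c' (fun k x => sin (k%:R * x)) C NU
  (fun k x => sin_max _) c'C kc'C.
have bcos m : bounded_mfun (cos_poly _ (c m) (N m))
  by apply: continuous_bounded_mfun; exact: cos_poly_continuous.
have bsin m : bounded_mfun (sin_poly _ (c' m) (N m))
  by apply: continuous_bounded_mfun; exact: sin_poly_continuous.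
have exU (P : nat -> Prop) : (\forall m \near U, P m) -> exists m,
  P m by move=> /filter_ex.
have bu : bounded_mfun u.
  apply: (bounded_mfun_unif_lim _ _ _ bcos) => e e0.
  by have [m mP] := exU _ (uU e e0); exists m => x _; exact: mP.
have bdu : bounded_mfun du.
  apply: (bounded_mfun_unif_lim _ _ _ bsin) => e e0.
  by have [m mP] := exU _ (duU e e0); exists m => x _; exact: mP.
have limu w : integrable0pi w ->
  integral0pi (fun x => cos_poly _ (c m) (N m) x * w x) @[m --> U]
  --> integral0pi (fun x => u x * w x).
  by move=> iw; apply: cvg_integral0pi_unif => // e e0;
    apply: filterS (uU e e0) => m mP x _; exact: mP.
have limdu w : integrable0pi w ->
  integral0pi (fun x => sin_poly _ (c' m) (N m) x * w x) @[m --> U]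
  --> integral0pi (fun x => du x * w x).
  by move=> iw; apply: cvg_integral0pi_unif => // e e0;
    apply: filterS (duU e e0) => m mP x _; exact: mP.
exists u; split => //; exists du; split.
  split; [exact: bounded_mfun_L2|exact: bounded_mfun_L2|move=> phi tphi].
  rewrite -!/(integral0pi _).
  have [_ cphi' _] := tphi.
  have cphi := is_derive_continuous _ _ _ (test_function_is_derive _ _ ^~ tphi).
  have L1 := limu _ (bounded_mfun_integrable _ _ (continuous_bounded_mfun _ _ cphi')).
  have L2 := limdu _ (bounded_mfun_integrable _ _ (continuous_bounded_mfun _ _ cphi)).
  have E m : integral0pi (fun x => cos_poly _ (c m) (N m) x * derive1 phi x) =
      - integral0pi (fun x => sin_poly _ (c' m) (N m) x * phi x).
    apply: smooth_weak_derivative => //; first exact: is_derive_cos_poly.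
    exact: sin_poly_continuous.
  have L3 : - integral0pi (fun x => sin_poly _ (c' m) (N m) x * phi x) @[m --> U]
    --> integral0pi (fun x => u x * derive1 phi x).
    by apply: cvg_trans L1; apply: near_eq_cvg; apply: nearW => m /=; rewrite E.
  by rewrite -(cvg_lim (@norm_hausdorff _ _) L3)
    -(cvg_lim (@norm_hausdorff _ _) (cvgN L2)).
move=> v dv Hv; rewrite -!/(integral0pi _).
have [v2 dv2 _] := Hv.
have iv := L2_integrable0pi _ _ v2; have idv := L2_integrable0pi _ _ dv2.
pose h m := cos_poly _ (fun k => k%:R * (k%:R * c m k)) (N m).
have bh m : bounded_mfun (h m) by apply: continuous_bounded_mfun;
  exact: cos_poly_continuous.
have dvh m : integral0pi (fun x => sin_poly _ (c' m) (N m) x * dv x)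
  = integral0pi (fun x => h m x * v x).
  have [s0 spi] := sin_poly_boundary _ (c' m) (N m).
  have := H1_parts _ _ _ _ _ Hv (fun x => is_derive_sin_poly _ (c' m) (N m) x)
    (cos_poly_continuous _ _ _) s0 spi.
  have -> : (fun x => dv x * sin_poly R (c' m) (N m) x)
    = (fun x => sin_poly R (c' m) (N m) x * dv x).
    by apply/funext => x; rewrite mulrC.
  move=> ->; rewrite -mulN1r -integral0piZ; last first.
    rewrite (_ : (fun x => _)
      = (fun x => cos_poly R (fun k => k%:R * c' m k) (N m) x * v x)); last first.
      by apply/funext => x; rewrite mulrC.
    by apply: integrable0piM => //; apply: continuous_bounded_mfun;
      exact: cos_poly_continuous.
  apply: eq_integral0pi => x _; rewrite mulN1r mulrC -mulNr; congr (_ * _).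
  by rewrite /h /cos_poly -sumrN; apply: eq_bigr => k _; rewrite /c'; ring.
(* The limit of the functions - u_m''. *)
pose g x := lam * u x - q x * u x.
have bq := cos_expansion_bounded_mfun.
have blu : bounded_mfun (fun x => lam * u x) by apply: bounded_mfunM => //;
  exact: bounded_mfun_cst.
have bqu : bounded_mfun (fun x => q x * u x) by exact: bounded_mfunM.
have bg : bounded_mfun g by exact: bounded_mfunB.
have limh : integral0pi (fun x => h m x * v x) @[m --> U]
  --> integral0pi (fun x => g x * v x).
  apply: cvg_integral0pi_unif => // e e0.
  have [Cu uC] := bu.2.
  pose S := tau 0%N.
  have S0 : 0 <= S by have := atau 0%N 0%N; rewrite big_geq.
  pose K := (Num.truncn (C * (S *+ 3) / (e / 8))).+1.
  have K0R : 0 < K%:R :> R by rewrite ltr0n.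
  have CK : C * (S *+ 3 / K%:R) <= e / 8.
    rewrite mulrA ler_pdivrMr//;
      have : C * (S *+ 3) / (e / 8) < K%:R by exact: truncnS_gt.
    by rewrite ltr_pdivrMr ?divr_gt0// => h1; lra.
  pose d0 := e / 8 / (C *+ 2 + 1).
  have C21 : 0 < C *+ 2 + 1 by rewrite ltr_wpDl// mulrn_wge0.
  have d00 : 0 < d0 by rewrite !divr_gt0.
  have /cvgrPdist_le/(_ _ d00) [L0 _ L0P] := tau0.
  pose Cu' := `|Cu|.
  have uC' x : itv0pi x -> `|u x| <= Cu' by move=> /uC /le_trans; apply;
    exact: ler_norm.
  have Cu0 : 0 <= Cu' by exact: normr_ge0.
  pose d1 := e / 4 / (S + `|lam| + 1).
  have SL : 0 < S + `|lam| + 1 by rewrite ltr_wpDl// addr_ge0.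
  have d10 : 0 < d1 by rewrite !divr_gt0.
  pose d2 := e / 4 / (Cu' + 1).
  have Cu1 : 0 < Cu' + 1 by rewrite ltr_wpDl.
  have d20 : 0 < d2 by rewrite !divr_gt0.
  near=> m => x Ix.
  have um : `|cos_poly _ (c m) (N m) x - u x| <= d1.
    by move: x {Ix}; near: m; exact: uU.
  have lm1 : `|lam - l m| <= 1.
    by near: m; move/cvgrPdist_le : llam; apply.
  have lm2 : `|lam - l m| <= d2.
    by near: m; move/cvgrPdist_le : llam; apply.
  have Nm : (L0 + K <= N m)%N by near: m; exact: NU.
  have rm : `|h m x + q x * cos_poly _ (c m) (N m) x - l m
    * cos_poly _ (c m) (N m) x| <= e / 4.
    have -> : h m x = \sum_(0 <= k < N m) k%:R ^+ 2 * c m k * cos (k%:R * x).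
      by rewrite /h /cos_poly; apply: eq_bigr => k _; rewrite expr2 !mulrA.
    have NK : (L0 <= N m - K)%N by move: Nm; clear; lia.
    have := @residual_bound R a S C (tau (N m - K)) (q x) (l m) x K (N m) (c m)
      (atau 0%N)
      (atau _) (fun M h => qtau _ M x h Ix) (cos_expansion_bound _ Ix) _ (sC m)
        (s2C m) (ev m).
    move=> /(_ _)/le_trans; apply; first by apply: leq_trans Nm; rewrite leq_addl.
    have := L0P _ NK; rewrite sub0r normrN => /(le_trans (ler_norm _)) tN.
    rewrite mulrDr.
    have : C * (tau (N m - K) *+ 2) <= e / 8; last by lra.
    apply: (@le_trans _ _ ((C *+ 2) * d0)).
      by rewrite mulrnAr -mulrnAl ler_wpM2l// mulrn_wge0.
    by rewrite /d0 mulrA ler_pdivrMr// mulrC ler_wpM2l ?lerDl// divr_ge0 // ltW.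
  set um' := cos_poly _ (c m) (N m) x in um rm *.
  have -> : h m x - g x = (h m x + q x * um' - l m * um') - q x * (um' - u x)
     + l m * (um' - u x) - (lam - l m) * u x by rewrite /g; ring.
  have t1 : `|q x * (um' - u x)| <= S * d1.
    by rewrite normrM ler_pM// cos_expansion_bound.
  have t2 : `|l m * (um' - u x)| <= (`|lam| + 1) * d1.
    rewrite normrM ler_pM//; have -> : l m = lam - (lam - l m) by ring.
    by rewrite (le_trans (ler_normB _ _))// lerD2l.
  have t3 : `|(lam - l m) * u x| <= d2 * Cu' by rewrite normrM ler_pM// uC'.
  have t12 : S * d1 + (`|lam| + 1) * d1 = e / 4.
    by rewrite -mulrDl addrA /d1 mulrC mulfVK// lt0r_neq0.
  have t33 : d2 * Cu' <= e / 4.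
    by rewrite /d2 mulrAC ler_pdivrMr// ler_wpM2l ?lerDl// divr_ge0// ltW.
  have := ler_normB (h m x + q x * um' - l m * um' - q x * (um' - u x) + l m
    * (um' - u x)) ((lam - l m) * u x).
  have := ler_normD (h m x + q x * um' - l m * um' - q x * (um' - u x))
    (l m * (um' - u x)).
  have := ler_normB (h m x + q x * um' - l m * um') (q x * (um' - u x)).
  move: rm t1 t2 t3 t12 t33; lra.
have limdv : integral0pi (fun x => h m x * v x) @[m --> U]
  --> integral0pi (fun x => du x * dv x).
  by apply: cvg_trans (limdu _ idv); apply: near_eq_cvg; apply: nearW => m /=;
    rewrite dvh.
have -> : integral0pi (fun x => du x * dv x) = integral0pi (fun x => g x * v x).
  by rewrite -(cvg_lim (@norm_hausdorff _ _) limdv)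
    -(cvg_lim (@norm_hausdorff _ _) limh).
have iuv : integrable0pi (fun x => u x * v x) by exact: integrable0piM.
have iquv : integrable0pi (fun x => q x * u x * v x) by exact: integrable0piM.
have -> : (fun x => g x * v x)
  = (fun x => lam * (u x * v x) + -1 * (q x * u x * v x)).
  by apply/funext => x; rewrite /g; ring.
rewrite integral0piD; [|exact: integrable0piZ|exact: integrable0piZ].
by rewrite !integral0piZ// mulN1r subrK.
Unshelve. all: by end_near. Qed.
End limit.

(** * Existence of the lowest eigenfunctions *)

(** The value of the form at the cosine polynomial with normalised coefficients y.
    *)
Definition galerkin_energy {R : realType} (a : nat -> R) (N : nat) (y : nat -> R) : R
  :=
  \sum_(j < N) \sum_(k < N) y j * galerkin a j k * y k.

Definition orthonormal {R : realType} (N n : nat) (y : 'I_n -> nat -> R) : Prop :=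
  forall i j, \sum_(k < N) y i k * y j k = (i == j)%:R.

Lemma sum_truncate (R : realType) N M (f : nat -> R) : (N <= M)%N ->
  \sum_(k < M) (if (k < N)%N then f k else 0) = \sum_(k < N) f k.
Proof.
move=> NM; rewrite -(big_mkord xpredT (fun k => if (k < N)%N then f k else 0)).
rewrite (@big_cat_nat _ _ _ N 0 M)//= [X in _ + X]big1_seq ?addr0; last first.
  by move=> k; rewrite mem_index_iota => /andP[_ /andP[Nk _]]; rewrite ltnNge Nk.
by rewrite big_mkord; apply: eq_bigr => k _; rewrite ltn_ord.
Qed.

Lemma galerkin_energy_truncate (R : realType) (a : nat -> R) N M (y : nat -> R) :
  (N <= M)%N ->
  galerkin_energy a M (fun k => if (k < N)%N then y k else 0) = galerkin_energy a N y.
Proof.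
move=> NM; rewrite /galerkin_energy
  -(sum_truncate _ _ _ (fun j => \sum_(k < N) y j * galerkin a j k * y k) NM).
apply: eq_bigr => j _; case: ifP => jN; last first.
  by rewrite big1// => k _; rewrite !mul0r.
rewrite -(sum_truncate _ _ _ (fun k => y j * galerkin a j k * y k) NM).
by apply: eq_bigr => k _; case: ifP => _ //; rewrite mulr0.
Qed.

Lemma orthonormal_truncate (R : realType) N M n (y : 'I_n -> nat -> R) :
  (N <= M)%N -> orthonormal N n y ->
  orthonormal M n (fun i k => if (k < N)%N then y i k else 0).
Proof.
move=> NM yy i j; rewrite -yy -(sum_truncate _ _ _ (fun k => y i k * y j k) NM).
by apply: eq_bigr => k _; case: ifP => _ //; rewrite mulr0.
Qed.

Section eigenfunctions.
Variables (R : realType) (a tau : nat -> R) (q : R -> R).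
Hypothesis aq : cos_expansion a tau q.

(** The lowest eigenpairs of the truncations of size n + m, in the limit along an
    ultrafilter on m. An orthonormal family of size N is extended by zero to the
    larger truncations. *)
Lemma exists_eigenfunctions n : exists (lam : 'I_n -> R) (u : 'I_n -> R -> R),
  [/\ forall i, weak_neumann q (lam i) (u i) /\ bounded_mfun (u i),
      forall i j, integral0pi (fun x => u i x * u j x) = pi / 2 * (i == j)%:R,
      forall i j : 'I_n, (i <= j)%N -> lam i <= lam j &
      forall N y, orthonormal N n y ->
        \sum_i lam i <= \sum_i galerkin_energy a N (y i)].
Proof.
have [atau _ _] := aq; have aS := atau 0%N; set S := tau 0%N in aS.
have S0 : 0 <= S by have := aS 0%N; rewrite big_geq.
pose N m := (n + m)%N.
have nN m : (n <= N m)%N by exact: leq_addr.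
have [x xP] := choice (fun m =>
  galerkin_eigenpairs R (N m) n (galerkin a) (galerkinC R a) (nN m)).
have {xP}[l lP] := choice xP.
have xx m i j : \sum_(k < N m) x m i k * x m j k = (i == j)%:R by case: (lP m).
have ev m i (j : nat) : (j < N m)%N ->
  \sum_(k < N m) galerkin a j k * x m i k = l m i * x m i j.
  by case: (lP m) => _ h _ _ _; exact: h.
have ls m (i j : 'I_n) : (i <= j)%N -> l m i <= l m j by case: (lP m) => _ _ h _ _;
  exact: h.
have x0 m i k : (N m <= k)%N -> x m i k = 0 by case: (lP m) => _ _ _ h _; exact: h.
have lmin m y : orthonormal (N m) n y ->
  \sum_i l m i <= \sum_i galerkin_energy a (N m) (y i).
  by case: (lP m) => _ _ _ _; exact.
have [L LP] := galerkin_eigenvalues_bounded _ a S n aS.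
have lL m i : `|l m i| <= L.
  by apply: (LP (N m) (x m) (l m)) => //; [exact: ev|exact: lmin].
have x1 m i k : `|x m i k| <= 1.
  have [kN|kN] := ltnP k (N m); last by rewrite x0// normr0.
  rewrite -(@ler_pXn2r _ 2)// ?nnegrE// expr1n real_normK ?num_real//.
  have <- : \sum_(k < N m) x m i k * x m i k = 1 by rewrite xx eqxx.
  rewrite (bigD1 (Ordinal kN))//= -expr2 lerDl.
  by apply: sumr_ge0 => j _; rewrite -expr2 sqr_ge0.
pose c i m k := Num.sqrt (cos_weight R k) * x m i k.
pose C := (L + S *+ 2) * (1 + (L + S *+ 2) * 2) + 1.
have bd m i := @eigenvector_l1_bounds R a S L (l m i) (N m) (x m i) aS (lL m i)
  (x1 m i) (ev m i).
have cx i m k : `|c i m k| <= `|x m i k|.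
  by rewrite /c normrM ger0_norm ?sqrt_cos_weight_ge0// ler_piMl//
    sqrt_cos_weight_le1.
have s2x m i : \sum_(0 <= k < N m) k%:R ^+ 2 * `|x m i k| <= C - 1.
  by rewrite /C addrK; have [_] := bd m i.
have C1 (i : 'I_n) : 1 <= C.
  rewrite -subr_ge0; apply: le_trans (s2x 0%N i).
  by apply: sumr_ge0 => k _; rewrite mulr_ge0// sqr_ge0.
have cC i m k : `|c i m k| <= C
  by rewrite (le_trans (cx _ _ _))// (le_trans (x1 _ _ _))// (C1 i).
have c0 i m k : (N m <= k)%N -> c i m k = 0 by move=> h; rewrite /c x0// mulr0.
have s2C i m : \sum_(0 <= k < N m) k%:R ^+ 2 * `|c i m k| <= C.
  apply: (@le_trans _ _ (C - 1)); last by rewrite gerBl.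
  by apply: le_trans (s2x m i); apply: ler_sum => k _; rewrite ler_wpM2l// sqr_ge0.
have sC i m : \sum_(0 <= k < N m) `|c i m k| <= C.
  have := s2x m i; case: (N m) => [|p] h;
    first by rewrite big_geq// (le_trans ler01)// (C1 i).
  rewrite big_nat_recl// -[C](subrK 1) addrC lerD ?(le_trans (cx _ _ _))//.
  apply: le_trans h; rewrite big_nat_recl// expr0n mul0r add0r; apply: ler_sum => k _.
  by rewrite (le_trans (cx _ _ _))// ler_peMl// expr_ge1 // ler1n.
have evc i m j : (j < N m)%N -> j%:R ^+ 2 * c i m j
      + cos_weight R j * \sum_(0 <= k < N m) mult_coef a j k * c i m k = l m i
        * c i m j.
  by move=> jN; have [h _] := bd m i; exact: h.
have [U [UU FU]] := ultraFilterLemma (@eventually_filter).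
have NU K : \forall m \near U, (K <= N m)%N.
  by apply: FU; exists K => // m /=; rewrite /N => Km;
    rewrite (leq_trans Km)// leq_addl.
have lcvg i : cvg (l m i @[m --> U]) := ultra_cvg U UU _ _ (lL ^~ i).
pose lam i := lim (l m i @[m --> U]).
have [u uP] := choice (fun i =>
  weak_limit _ _ _ _ aq U N (c i) (l ^~ i) C (lam i) UU NU (cC i) (c0 i) (sC i)
    (s2C i) (evc i) (lcvg i)).
exists lam, u; split.
- by move=> i; have [] := uP i.
- move=> i j; have [bui uiU _] := uP i; have [buj ujU _] := uP j.
  have bcos i' m : bounded_mfun (cos_poly _ (c i' m) (N m))
    by apply: continuous_bounded_mfun; exact: cos_poly_continuous.
  have E m : integral0pi (fun x =>
    cos_poly _ (c i m) (N m) x * cos_poly _ (c j m) (N m) x * 1) = pi / 2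
    * (i == j)%:R.
    under eq_fun do rewrite mulr1.
    rewrite integral0pi_cos_poly -(xx m) big_mkord; congr (_ * _);
      apply: eq_bigr => k _.
    rewrite /c -[X in _ / X](sqr_sqrt_cos_weight R k); field.
    by rewrite sqrtr_eq0 -ltNge cos_weight_gt0.
  have [Ci uiC] := bui.2.
  have lim1 : integral0pi (fun x =>
    cos_poly _ (c i m) (N m) x * cos_poly _ (c j m) (N m) x * 1) @[m --> U]
     --> integral0pi (fun x => u i x * u j x * 1).
    apply: cvg_integral0pi_unif; first by move=> m; exact: bounded_mfunM.
    + exact: bounded_mfunM.
    + by apply: bounded_mfun_integrable; exact: bounded_mfun_cst.
    move=> e e0.
    have C0 : 0 < C by exact: lt_le_trans ltr01 (C1 i).
    pose C' := `|Ci|.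
    have CC : 0 < C + C' by rewrite ltr_pwDl// normr_ge0.
    have d0 : 0 < e / (C + C') by rewrite divr_gt0.
    apply: filterS (filterI (uiU _ d0) (ujU _ d0)) => m [mi mj] z Iz.
    set p := cos_poly _ (c i m) (N m) z; set r := cos_poly _ (c j m) (N m) z.
    have -> : p * r - u i z * u j z = (p - u i z) * r + u i z * (r - u j z) by ring.
    have rC : `|r| <= C.
      apply: le_trans (sC j m);
        rewrite /r /cos_poly (le_trans (ler_norm_sum _ _ _))//.
      by apply: ler_sum => k _; rewrite normrM ler_piMr// cos_max.
    have uC' : `|u i z| <= C' by apply: le_trans (uiC z Iz) (ler_norm _).
    have -> : e = e / (C + C') * C + C' * (e / (C + C')) by field; exact: lt0r_neq0.
    apply: le_trans (ler_normD _ _) _; apply: lerD; rewrite normrM;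
      apply: ler_pM => //.
      exact: mi.
    exact: mj.
  have -> : integral0pi (fun x => u i x * u j x)
    = integral0pi (fun x => u i x * u j x * 1).
    by apply: eq_integral0pi => z _; rewrite mulr1.
  rewrite -(cvg_lim (@norm_hausdorff _ _) lim1).
  by under eq_fun do rewrite E; rewrite lim_cst.
- move=> i j ij; apply: ler_lim; [exact: lcvg|exact: lcvg|].
  by apply: filterE => m; exact: ls.
- move=> M y yy.
  have lims : \sum_i l m i @[m --> U] --> \sum_i lam i.
    by apply: cvg_sum_seq => i _; exact: lcvg.
  rewrite -(cvg_lim (@norm_hausdorff _ _) lims).
  apply: limr_le; first by apply/cvg_ex; eexists; exact: lims.
  apply: filterS (NU M) => m Mm.
  apply: le_trans (lmin m _ (orthonormal_truncate _ _ _ _ _ Mm yy)) _.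
  by apply: ler_sum => i _; rewrite galerkin_energy_truncate.
Qed.

End eigenfunctions.

(** * Comparison of the two lists of eigenvalues *)

Lemma cos_sumE (R : realType) (a : nat -> R) n x :
  cos_sum a n.+1 x = a 0%N / 2 + \sum_(1 <= k < n.+1) a k * cos (k%:R * x).
Proof.
rewrite /cos_sum big_ltn// /cos_weight eqxx mul0r cos0; congr (_ + _); first by field.
by apply: eq_big_nat => -[|k] //= _; rewrite mul1r.
Qed.

Lemma cos_expansion_of_abs_cvg (R : realType) (q : R -> R) :
  abs_cvg_cos_expansion q -> exists tau, cos_expansion (cos_coef q) tau q.
Proof.
move=> [acvg qcvg]; set a := cos_coef q.
pose s := series (fun k => `|a k|).
have sle n : s n <= limn s.
  apply: nondecreasing_cvgn_le => //; apply/nondecreasing_seqP => m.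
  by rewrite /s /series /= big_nat_recr//= lerDl.
have atau L n : \sum_(L <= i < n) `|a i| <= limn s - s L.
  have [Ln|nL] := leqP L n; last by rewrite big_geq ?(ltnW nL)// subr_ge0 sle.
  rewrite lerBrDl; apply: le_trans (sle n).
  by rewrite /s /series /= [leRHS](@big_cat_nat _ _ _ L 0 n).
exists (fun L => limn s - s L); split=> //.
- move=> L M x LM; rewrite /itv0pi /= in_itv /= => /andP[x0 xpi].
  apply/ler_addgt0Pr => e e0.
  have xI : 0 <= x <= pi by rewrite !ltW.
  have /cvgrPdist_le/(_ _ e0)[n0 _ n0P] := qcvg x xI.
  pose n := maxn n0 M; have := n0P n (leq_maxl _ _); rewrite /= -cos_sumE => qn.
  have nM : (M <= n.+1)%N by rewrite leqW// leq_maxr.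
  have h1 : `|cos_sum a n.+1 x - cos_sum a M x| <= limn s - s M.
    apply: le_trans (atau M n.+1).
    rewrite /cos_sum (@big_cat_nat _ _ _ M 0 n.+1)//= addrAC subrr add0r.
    rewrite (le_trans (ler_norm_sum _ _ _))// ler_sum// => i _.
    rewrite !normrM (ger0_norm (ltW (cos_weight_gt0 _ _))) -[leRHS]mulr1.
    by apply: ler_pM; rewrite ?mulr_ge0 ?cos_max ?(ltW (cos_weight_gt0 _ _))//
      ler_piMl// cos_weight_le1.
  have h2 : s L <= s M.
    by rewrite /s /series /= [leRHS](@big_cat_nat _ _ _ L 0 M)//= lerDl sumr_ge0.
  have := ler_normD (q x - cos_sum a n.+1 x) (cos_sum a n.+1 x - cos_sum a M x).
  rewrite addrA subrK; move: qn h1 h2; rewrite -/a; lra.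
- have /(cvgB (cvg_cst (limn s))) : s n @[n --> \oo] --> limn s by [].
  by rewrite subrr.
Qed.

(** Almost everywhere equality is tested by integration against the functions of the
    family. *)
Lemma lin_indep_of_orthogonal (R : realType) d (u : 'I_d -> R -> R) (h : R) :
    (forall i, bounded_mfun (u i)) -> h != 0 ->
    (forall i j, integral0pi (fun x => u i x * u j x) = h * (i == j)%:R) ->
  lin_indep u.
Proof.
move=> bu h0 uu c cu j.
have E : integral0pi (fun x => (\sum_(i < d) c i * u i x) * u j x) = c j * h.
  have -> : (fun x => (\sum_(i < d) c i * u i x) * u j x) =
     (fun x => \sum_(i < d) c i * (u i x * u j x)).
    by apply/funext => x; rewrite mulr_suml; apply: eq_bigr => i _; rewrite mulrA.
  have iuu i : integrable0pi (fun x => u i x * u j x)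
    by apply: bounded_mfun_integrable; exact: bounded_mfunM.
  rewrite integral0pi_sum; last by move=> i; exact: integrable0piZ.
  under eq_bigr do rewrite integral0piZ// uu.
  rewrite (bigD1 j)//= eqxx mulr1 big1 ?addr0// => i /negPf->.
  by rewrite mulr0 mulr0.
have bs : bounded_mfun (fun x => (\sum_(i < d) c i * u i x) * u j x).
  apply: bounded_mfunM => //; have : forall i, bounded_mfun (fun x => c i * u i x).
    by move=> i; apply: bounded_mfunM => //; exact: bounded_mfun_cst.
  move: (index_enum _) => r bcu; elim: r => [|i r IH].
    by under eq_fun do rewrite big_nil; exact: bounded_mfun_cst.
  by under eq_fun do rewrite big_cons; exact: bounded_mfunD.
have E0 : integral0pi (fun x => (\sum_(i < d) c i * u i x) * u j x) = 0.
  rewrite /integral0pi /Rintegral (ae_eq_integral (cst 0%E)) ?integral0//.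
  - exact: measurable_itv0pi.
  - by case/integrableP : (bounded_mfun_integrable _ _ bs).
  - move: cu; apply: (@filterS _ _ (ae_filter_ringOfSetsType (@lebesgue_measure R)))
    => x /= H /H ->; by rewrite mul0r.
by move/eqP : E; rewrite E0 eq_sym mulf_eq0 (negPf h0) orbF => /eqP.
Qed.

(** The multiplicity condition yields an injection F of the indices with mu (F i) =
    lam i. Among the k + 1 values F i, i <= k, one is at least k, and for that i: mu
    k <= mu (F i) = lam i <= lam k. *)
Lemma nondecr_le_of_multiplicities (R : realType) n (lam : 'I_n -> R) (mu : nat -> R)
  :
    (forall i j : 'I_n, (i <= j)%N -> lam i <= lam j) ->
    (forall k, mu k <= mu k.+1) ->
    (forall l, exists k : 'I_#|[pred i | lam i == l]| -> nat,
        injective k /\ forall i, mu (k i) = l) ->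
  forall i : 'I_n, mu i <= lam i.
Proof.
move=> ls ms H.
have mono p r : (p <= r)%N -> mu p <= mu r by have /nondecreasing_seqP := ms; exact.
have H' l : exists f : 'I_n -> nat,
    (forall i, lam i = l -> mu (f i) = l) /\
    (forall i j, lam i = l -> lam j = l -> f i = f j -> i = j).
  have [k [kinj kl]] := H l; set A := [pred i | lam i == l] in k kinj kl.
  have ltA i : lam i = l -> (index i (enum A) < #|A|)%N.
    by move=> il; rewrite cardE index_mem mem_enum inE /= il.
  exists (fun i => oapp k 0%N (insub (index i (enum A)))); split.
    by move=> i il; rewrite (insubT (fun p => (p < #|A|)%N) (ltA i il)) /= kl.
  move=> i j il jl.
  rewrite (insubT (fun p => (p < #|A|)%N) (ltA i il))
    (insubT (fun p => (p < #|A|)%N) (ltA j jl)) /=.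
  move=> /kinj /(congr1 val) /= ij.
  have iA : i \in enum A by rewrite mem_enum inE /= il.
  have jA : j \in enum A by rewrite mem_enum inE /= jl.
  by rewrite -(nth_index i iA) ij nth_index.
have [f fP] := choice H'.
pose F i := f (lam i) i.
have muF i : mu (F i) = lam i by have [h _] := fP (lam i); exact: h.
have Finj : injective F.
  move=> i j ij; have lij : lam i = lam j by rewrite -!muF ij.
  by have [_ h] := fP (lam i); apply: h => //; move: ij; rewrite /F -lij.
move=> k; have [[i [ik Fi]]|no] :=
  pselect (exists i : 'I_n, (i <= k)%N /\ (k <= F i)%N).
  by apply: le_trans (mono _ _ Fi) _; rewrite muF ls.
have lt (i : 'I_k.+1) : (F (widen_ord (ltn_ord k) i) < k)%N.
  rewrite ltnNge; apply/negP => h; apply: no; exists (widen_ord (ltn_ord k) i);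
    split => //=.
  by rewrite -ltnS.
(* Otherwise F would inject k + 1 indices into k values. *)
have ginj : injective (fun i => Ordinal (lt i)).
  by move=> i j /(congr1 val) /= /Finj /(congr1 val) /= ij; apply: val_inj.
by have := leq_card _ ginj; rewrite !card_ord ltnn.
Qed.

(** Ky Fan's inequality for the Neumann problem, on cosine polynomials. *)
Lemma sum_mu_le_energy (R : realType) (q : R -> R) (mu : nat -> R) n N
    (y : 'I_n -> nat -> R) :
    abs_cvg_cos_expansion q -> neumann_eigenvalues q mu -> orthonormal N n y ->
  \sum_(i < n) mu i <= \sum_i galerkin_energy (cos_coef q) N (y i).
Proof.
move=> hq [mono hmu] yy.
have [tau aq] := cos_expansion_of_abs_cvg _ _ hq.
have [lam [u [uw uu ls kf]]] := exists_eigenfunctions _ _ _ _ aq n.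
apply: le_trans (kf N y yy); apply: ler_sum => i _.
apply: nondecr_le_of_multiplicities => // l.
apply/hmu; exists (fun i => u (enum_val i)); split.
  move=> p; have := enum_valP p; rewrite inE /= => /eqP lp.
  by have := (uw (enum_val p)).1; rewrite lp.
apply: (lin_indep_of_orthogonal _ _ _ (pi / 2)).
- by move=> p; exact: (uw _).2.
- by rewrite lt0r_neq0// divr_gt0 ?pi_gt0.
- by move=> p r; rewrite uu (inj_eq enum_val_inj).
Qed.

(** * The inequality, the case of equality and the limit *)

Lemma sum_two_delta (R : realType) N (i m : nat) (al be : R) (f : nat -> R) :
    (i < N)%N -> (m < N)%N ->
  \sum_(k < N) (al * (i == k :> nat)%:R + be * (m == k :> nat)%:R) * f k = al * f i
    + be * f m.
Proof.
move=> iN mN; under eq_bigr do rewrite mulrDl -!mulrA.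
by rewrite big_split /= -!mulr_sumr !sum_delta_row.
Qed.

Lemma galerkin_energy_two (R : realType) (a : nat -> R) N (i m : nat) (al be : R) :
    (i < N)%N -> (m < N)%N ->
  galerkin_energy a N (fun k => al * (i == k)%:R + be * (m == k)%:R) =
  al ^+ 2 * galerkin a i i + al * be * galerkin a i m *+ 2 + be ^+ 2 * galerkin a m m.
Proof.
move=> iN mN; rewrite /galerkin_energy.
under eq_bigr => j _.
  under eq_bigr do rewrite -mulrA.
  rewrite -mulr_sumr.
  under eq_bigr do rewrite mulrC.
  rewrite (sum_two_delta _ _ _ _ _ _ (galerkin a j) iN mN).
  over.
rewrite (sum_two_delta _ _ _ _ _ _
  (fun j => al * galerkin a j i + be * galerkin a j m) iN mN).
by rewrite (galerkinC _ a m i); ring.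
Qed.

(** The first n basis vectors, with the one of index i0 rotated towards the one of
    index m >= n. *)
Lemma orthonormal_two (R : realType) N n (m : nat) (al be : 'I_n -> R) (i0 : 'I_n) :
    (n <= m)%N -> (m < N)%N ->
    (forall i, i != i0 -> al i = 1 /\ be i = 0) ->
    al i0 ^+ 2 + be i0 ^+ 2 = 1 ->
  orthonormal N n (fun i k => al i * (i == k :> nat)%:R + be i * (m == k)%:R).
Proof.
move=> nm mN H H0 p r; have pN := leq_ltn_trans (leq_trans (ltnW (ltn_ord p)) nm) mN.
rewrite (sum_two_delta _ _ _ _ _ _
  (fun k => al r * (r == k :> nat)%:R + be r * (m == k)%:R) pN mN).
have neq (s : 'I_n) : ((s : nat) == m) = false
  by rewrite ltn_eqF// (leq_trans (ltn_ord s)).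
rewrite !eqxx neq [m == p]eq_sym neq !mulr0 addr0 add0r mulr1.
rewrite (inj_eq val_inj) eq_sym; have [<-|pr] := eqVneq p r.
  rewrite mulr1 -!expr2; have [->//|/H [-> ->]] := eqVneq p i0.
  by rewrite expr0n expr1n addr0.
rewrite !mulr0 add0r; have [pi0|/H [_ ->]] := eqVneq p i0; last by rewrite mul0r.
have : r != i0 by rewrite -pi0 eq_sym.
by move=> /H [_ ->]; rewrite mulr0.
Qed.

Lemma galerkin_diag (R : realType) (a : nat -> R) k :
  galerkin a k k = k%:R ^+ 2 + a 0%N / 2 + (if k == 0%N then 0 else a (2 * k)%N / 2).
Proof.
rewrite /galerkin eqxx mul1r sqr_sqrt_cos_weight /mult_coef /nat_dist subnn addn0
  /cos_weight mul2n addnn -addrA.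
by congr (_ + _); case: eqP => [->|_]; rewrite ?double0; field.
Qed.

Lemma sum_galerkin_diag (R : realType) (a : nat -> R) n :
  \sum_(0 <= k < n.+1) (galerkin a k k - k%:R ^+ 2 - a 0%N / 2) =
  1 / 2 * \sum_(1 <= k < n.+1) a (2 * k)%N.
Proof.
rewrite big_ltn// [X in X + _](_ : _ = 0) ?add0r; last by rewrite galerkin_diag /=;
  ring.
rewrite mulr_sumr; apply: eq_big_nat => -[|k] //= _; rewrite galerkin_diag /=;
  by field.
Qed.

Lemma sum_mu_le (R : realType) (q : R -> R) (mu : nat -> R) n :
    abs_cvg_cos_expansion q -> neumann_eigenvalues q mu ->
  \sum_(i < n) mu i <= \sum_(i < n) galerkin (cos_coef q) i i.
Proof.
move=> hq hmu; case: n => [|n]; first by rewrite !big_ord0.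
pose al (i : 'I_n.+1) : R := 1; pose be (i : 'I_n.+1) : R := 0.
have o := @orthonormal_two R n.+2 n.+1 n.+1 al be ord0 (leqnn _) (leqnn _)
  (fun _ _ => conj erefl erefl).
have := sum_mu_le_energy _ _ _ _ _ _ hq hmu (o _);
  rewrite /al /be expr1n expr0n addr0 => /(_ erefl).
move=> /le_trans; apply; rewrite le_eqVlt; apply/orP; left; apply/eqP.
apply: eq_bigr => i _.
rewrite (galerkin_energy_two _ _ _ _ _ _ _ (leqW (ltn_ord i)) (ltnSn _)).
by rewrite expr1n expr0n /=; ring.
Qed.

(** The rotated family has parameter t = tan of the angle. After multiplication by 1
    + t^2, Ky Fan's inequality for it reads 0 <= 2 t A_im + t^2 (A_mm - A_ii), for
    all t. *)
Lemma galerkin_offdiag_eq0 (R : realType) (q : R -> R) (mu : nat -> R) n (i0 : 'I_n)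
  m :
    abs_cvg_cos_expansion q -> neumann_eigenvalues q mu ->
    \sum_(i < n) mu i = \sum_(i < n) galerkin (cos_coef q) i i -> (n <= m)%N ->
  galerkin (cos_coef q) i0 m = 0.
Proof.
move=> hq hmu E nm; set a := cos_coef q in E *.
apply: (@linear_term_eq0 _ _ (galerkin a m m - galerkin a i0 i0)) => t.
have den : 0 < 1 + t ^+ 2 by rewrite ltr_pwDl// sqr_ge0.
have lt (i : 'I_n) : (i < m.+1)%N by rewrite ltnW// ltnS (leq_trans (ltn_ord i)).
pose r := (Num.sqrt (1 + t ^+ 2))^-1.
have r2 : r ^+ 2 = (1 + t ^+ 2)^-1 by rewrite /r exprVn sqr_sqrtr// ltW.
pose al (i : 'I_n) : R := if i == i0 then r else 1.
pose be (i : 'I_n) : R := if i == i0 then t * r else 0.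
have o : orthonormal m.+1 n
  (fun i k => al i * (i == k :> nat)%:R + be i * (m == k)%:R).
  apply: (@orthonormal_two _ _ _ _ _ _ i0) => //.
    by move=> i /negPf ii0; rewrite /al /be ii0.
  by rewrite /al /be eqxx exprMn r2 -[X in X + _]mul1r -mulrDl mulfV// lt0r_neq0.
have := sum_mu_le_energy _ _ _ _ _ _ hq hmu o; rewrite E -/a.
rewrite (bigD1 i0)//= [X in _ <= X](bigD1 i0)//=.
have -> : \sum_(i < n | i != i0) galerkin_energy a m.+1
  (fun k => al i * (i == k :> nat)%:R + be i * (m == k)%:R)
   = \sum_(i < n | i != i0) galerkin a i i.
  apply: eq_bigr => i /negPf ii0;
    rewrite (galerkin_energy_two _ _ _ _ _ _ _ (lt i) (ltnSn _)).
  by rewrite /al /be ii0 expr1n expr0n /=; ring.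
rewrite lerD2r (galerkin_energy_two _ _ _ _ _ _ _ (lt i0) (ltnSn _)).
rewrite /al /be eqxx exprMn r2.
have -> : r * (t * r) = t * r ^+ 2 by ring.
rewrite r2 -subr_ge0 -(pmulr_rge0 _ den); congr (_ <= _).
field; exact: lt0r_neq0.
Qed.

Lemma cos_natpi (R : realType) n : cos (n%:R * pi : R) = (-1) ^+ n.
Proof.
elim: n => [|n IH]; first by rewrite mul0r cos0.
by rewrite -natr1 mulrDl mul1r cosDpi IH exprS mulN1r.
Qed.

(** At 0 all cosines are 1, and at pi they alternate, so the odd terms cancel in the
    sum. *)
Lemma sum_even_coefs (R : realType) (a : nat -> R) n :
  1 / 2 * \sum_(1 <= k < n.+1) a (2 * k)%N =
  (cos_sum a (2 * n).+1 0 + cos_sum a (2 * n).+1 pi - a 0%N) / 4.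
Proof.
rewrite !cos_sumE; elim: n => [|n IH].
  by rewrite !big_geq//; field.
rewrite big_nat_recr//= mulrDr IH.
rewrite (_ : (2 * n.+1)%N = (2 * n).+2); last by rewrite mulnS.
have ext (f : nat -> R) : \sum_(1 <= k < (2 * n).+3) f k =
    \sum_(1 <= k < (2 * n).+1) f k + f (2 * n).+1 + f (2 * n).+2.
  by rewrite big_nat_recr//= big_nat_recr.
rewrite (ext (fun k => a k * cos (k%:R * 0))) (ext (fun k => a k * cos (k%:R * pi))).
rewrite !mulr0 !cos0 !cos_natpi !exprS mul2n -signr_odd odd_double expr0.
by field.
Qed.

Theorem theorem3p3 (R : realType) (q : R -> R) (mu : nat -> R)
    (hq : abs_cvg_cos_expansion q) (hmu : neumann_eigenvalues q mu) :
  [/\ forall n : nat,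
        \sum_(0 <= k < n.+1) (mu k - k%:R ^+ 2 - cos_coef q 0 / 2)
        <= 1 / 2 * \sum_(1 <= k < n.+1) cos_coef q (2 * k),
      (exists n : nat,
        \sum_(0 <= k < n.+1) (mu k - k%:R ^+ 2 - cos_coef q 0 / 2)
        = 1 / 2 * \sum_(1 <= k < n.+1) cos_coef q (2 * k)) ->
      (exists c : R, forall x : R, 0 <= x <= pi -> q x = c) &
      (fun n : nat => 1 / 2 * \sum_(1 <= k < n.+1) cos_coef q (2 * k))
        @ \oo -->
        - (1 / (2 * pi)) * \int[@lebesgue_measure R]_(x in itv0pi) q x
        + (q 0 + q pi) / 4].
Proof.
set a := cos_coef q.
have diff n : 1 / 2 * \sum_(1 <= k < n.+1) a (2 * k)%N -
    \sum_(0 <= k < n.+1) (mu k - k%:R ^+ 2 - a 0%N / 2) =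
    \sum_(i < n.+1) galerkin a i i - \sum_(i < n.+1) mu i.
  rewrite -sum_galerkin_diag -!sumrB big_mkord.
  by apply: eq_bigr => k _; ring.
have cvgq x : 0 <= x <= pi -> cos_sum a n.+1 x @[n --> \oo] --> q x.
  by move=> xI; under eq_fun do rewrite cos_sumE; exact: hq.2.
split.
- by move=> n; rewrite -subr_ge0 diff subr_ge0 sum_mu_le.
- move=> [n /eqP]; rewrite eq_sym -subr_eq0 diff subr_eq0 => /eqP/esym E.
  (* The entry of row i and column m of the matrix is 0, and m <> i. *)
  have off (i m : nat) : (i <= n)%N -> (n < m)%N -> a (m - i)%N + a (m + i)%N = 0.
    move=> im nm; have := galerkin_offdiag_eq0 _ _ _ _ (Ordinal (im : (i < n.+1)%N))
      m hq hmu E nm.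
    rewrite /galerkin /= (ltn_eqF (leq_ltn_trans im nm)) mul0r add0r => /eqP.
    rewrite !mulf_eq0 !sqrtr_eq0 !leNgt !cos_weight_gt0 /= -/a invr_eq0 pnatr_eq0
      orbF => /eqP <-.
    by rewrite /nat_dist addnC; congr (a _ + a _); lia.
  have big m : (n < m)%N -> a m = 0.
    move=> nm; have := off 0%N m isT nm; rewrite subn0 addn0 => h; lra.
  have a0 j : (0 < j)%N -> a j = 0.
    move=> j0; have := off n (n + j)%N (leqnn _);
      rewrite -{1}[n]addn0 ltn_add2l => /(_ j0).
    by rewrite addKn (big (n + j + n)%N) ?addr0// -addnA -{1}[n]addn0 ltn_add2l
      addn_gt0 j0.
  exists (a 0%N / 2) => x xI.
  have := cvg_lim (@norm_hausdorff _ _) (cvgq x xI) => <-.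
  have -> : (fun m => cos_sum a m.+1 x) = (fun=> a 0%N / 2).
    apply/funext => m; rewrite cos_sumE big1_seq ?addr0// => k.
    by rewrite mem_index_iota => /andP[_ /andP[k0 _]]; rewrite a0// mul0r.
  by rewrite lim_cst.
- under eq_fun do rewrite sum_even_coefs.
  have c2 : (2 * n)%N @[n --> \oo] --> \oo.
    by move=> A [N _ NA]; exists N => // m /= Nm; apply: NA => /=; move: Nm; clear;
      lia.
  have p0 := pi_gt0 R.
  have l0 := cvgq 0 _; have lpi := cvgq pi _.
  have L0 := cvg_comp _ _ c2 (l0 _); have Lpi := cvg_comp _ _ c2 (lpi _).
  have -> : - (1 / (2 * pi)) * \int[@lebesgue_measure R]_(x in itv0pi) q x
    + (q 0 + q pi) / 4
     = (q 0 + q pi - a 0%N) / 4.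
    rewrite /a /cos_coef.
    under [in RHS]eq_Rintegral do rewrite mul0r cos0 mulr1.
    by have := lt0r_neq0 p0; move: (pi : R) => p pn0; field.
  apply: cvgMr_tmp; apply: cvgB; last exact: cvg_cst.
  apply: cvgD; [apply: L0|apply: Lpi]; by rewrite ?lexx ltW.
Qed.
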